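(* There is a universal constant $C>0$ such that the following holds. For every integer $r\ge 2$, all positive integers $m,T$ and every $\delta\in(0,1)$, there is a randomized online algorithm which, in each round $t\in[T]$, having observed $v_1,\dots,v_t$, outputs a unit vector $u_t\in S^{r-1}$, and which satisfies: for every sequence $v_1,\dots,v_T\in\mathbb{R}^m$ with $\|v_t\|_2\le1$ fixed in advance (oblivious adversary), with probability at least $1-\delta$ over the algorithm's randomness, $$\max_{t\in[T]}\ \mathbb{E}_{g}\Big\|\sum_{s=1}^t g_s v_s\Big\|_\infty \le C\sqrt{\log(mT/\delta)},$$ where, conditionally on the output, $g=(g_1,\dots,g_T)\sim\mathcal N(0,\Sigma^{(T)})$ with $\Sigma^{(T)}_{i,j}=\langle u_i,u_j\rangle$. The algorithm runs in time $O(mr)$ per round.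
   Context: $S^{r-1}$ denotes the unit sphere in $\mathbb{R}^r$. Since each $u_t$ is a unit vector, $\Sigma^{(T)}$ is a correlation matrix (PSD with unit diagonal), so each $g_s\sim\mathcal N(0,1)$.
   Formalization: The probability bound is proved under the added condition mT/δ ≥ 2, which excludes only m = T = 1 with δ > 1/2; there the claim fails for any universal C, since v_1 = 1 gives E|g_1| = √(2/π) while √log(1/δ) → 0 as δ → 1. *)

(* Defs.v *)
From HB Require Import structures.
From mathcomp Require Export all_boot all_order all_algebra.
From mathcomp Require Export all_classical all_reals all_analysis.
Export numFieldNormedType.Exports.
Export Order.TTheory GRing.Theory Num.Theory.

Set Implicit Arguments.
Unset Strict Implicit.
Unset Printing Implicit Defensive.

Local Open Scope classical_set_scope.
Local Open Scope ring_scope.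

(* Vectors of R^n are row vectors.  The library norm [`|x|] on 'rV[R]_n is the
   sup norm; the Euclidean one is [norm2]. *)

Definition dotp (R : realType) (n : nat) (x y : 'rV[R]_n) : R :=
  \sum_(k < n) x ord0 k * y ord0 k.

Definition norm2 (R : realType) (n : nat) (x : 'rV[R]_n) : R :=
  Num.sqrt (dotp x x).

Definition gram (R : realType) (n r : nat) (u : 'I_n -> 'rV[R]_r) : 'M[R]_n :=
  \matrix_(i < n, j < n) dotp (u i) (u j).

(* N(0, var).  The degenerate case is separate because the library's
   [normal_prob m 0] is the uniform law on [0, 1], not a point mass. *)
Definition gauss_law (R : realType) (var : R) (A : set R) : \bar R :=
  if var == 0 then \d_(0%R : R) A else normal_prob 0 (Num.sqrt var) A.

(* g ~ N(0, S), with S possibly singular: every linear combination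
   a_1 g_1 + ... + a_n g_n has law N(0, a S a^T). *)
Definition gaussian_vector (R : realType) (d : measure_display)
    (Q : measurableType d) (P : probability Q R) (n : nat)
    (g : 'I_n -> {RV P >-> R}) (S : 'M[R]_n) : Prop :=
  forall (a : 'rV[R]_n) (A : set R), measurable A ->
    P ((fun x => \sum_(s < n) a ord0 s * g s x) @^-1` A) =
    gauss_law ((a *m S *m a^T) ord0 ord0) A.

Definition mutually_independent (R : realType) (d : measure_display)
    (Q : measurableType d) (P : probability Q R) (I : eqType)
    (X : I -> {RV P >-> R}) : Prop :=
  forall (J : seq I) (A : I -> set R), uniq J -> (forall i, measurable (A i)) ->
    P (\bigcap_(i in [set` J]) (X i @^-1` A i)) =
    (\big[mule/1]_(i <- J) P (X i @^-1` A i))%E.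

(* Two sequences of ideal random numbers, all mutually independent: U_k uniform
   on [0, 1] and N_k standard normal. *)
Definition random_source (R : realType) (d : measure_display)
    (Q : measurableType d) (P : probability Q R)
    (U N : nat -> {RV P >-> R}) : Prop :=
  [/\ forall (k : nat) (A : set R), measurable A ->
        distribution P (U k) A = uniform_prob (@ltr01 R) A,
      forall (k : nat) (A : set R), measurable A ->
        distribution P (N k) A = normal_prob 0 1 A
    & mutually_independent
        (fun i : (nat + nat)%type => match i with inl k => U k | inr k => N k end)].

(* Algorithms are programs of a randomized real RAM with unit cost.  A machine
   has natural-number registers and real arrays indexed by natural numbers.  The
   only numeric constants are natural numbers, and reals cannot be rounded to
   naturals.  Loops are bounded, so every program is total.

   [For x e c] runs c with x = 0, ..., e - 1, where e is evaluated once, on entry.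
   [DrawU a e] and [DrawN a e] store in a[e] a fresh uniform, respectively
   standard normal, sample. *)

Inductive iexpr : Type :=
| IConst of nat
| IVar of nat
| IAdd of iexpr & iexpr
| ISub of iexpr & iexpr
| IMul of iexpr & iexpr.

Inductive rexpr : Type :=
| RNat of iexpr
| RGet of nat & iexpr
| RAdd of rexpr & rexpr
| RSub of rexpr & rexpr
| RMul of rexpr & rexpr
| RDiv of rexpr & rexpr
| RSqrt of rexpr
| RExp of rexpr
| RLn of rexpr.

Inductive bexpr : Type :=
| ILe of iexpr & iexpr
| RLe of rexpr & rexpr.

Inductive cmd : Type :=
| Skip
| ISet of nat & iexpr
| RSet of nat & iexpr & rexpr
| DrawU of nat & iexpr
| DrawN of nat & iexpr
| Seq of cmd & cmd
| If of bexpr & cmd & cmd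
| For of nat & iexpr & cmd.

Record state (R : realType) : Type := State {
  ireg : nat -> nat;
  rmem : nat -> nat -> R;
  draws : nat (* number of samples drawn so far *)
}.

Record tape (R : realType) : Type := Tape {
  tape_U : nat -> R;
  tape_N : nat -> R
}.

Section Machine.
Variable R : realType.
Implicit Types (s : state R) (w : tape R).

Definition set_ireg s (x k : nat) : state R :=
  State (fun y => if y == x then k else ireg s y) (rmem s) (draws s).

Definition set_rmem s (a i : nat) (z : R) : state R :=
  State (ireg s)
    (fun b j => if (b == a) && (j == i) then z else rmem s b j) (draws s).

Definition next_draw s : state R := State (ireg s) (rmem s) (draws s).+1.

(* ISub is truncated. *)
Fixpoint ieval s (e : iexpr) : nat :=
  match e with
  | IConst n => n
  | IVar x => ireg s x
  | IAdd e1 e2 => (ieval s e1 + ieval s e2)%N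
  | ISub e1 e2 => (ieval s e1 - ieval s e2)%N
  | IMul e1 e2 => (ieval s e1 * ieval s e2)%N
  end.

(* The library's conventions apply: z / 0 = 0, and sqrt z = 0 and ln z = 0 for
   z <= 0. *)
Fixpoint reval s (e : rexpr) : R :=
  match e with
  | RNat e1 => (ieval s e1)%:R
  | RGet a e1 => rmem s a (ieval s e1)
  | RAdd e1 e2 => reval s e1 + reval s e2
  | RSub e1 e2 => reval s e1 - reval s e2
  | RMul e1 e2 => reval s e1 * reval s e2
  | RDiv e1 e2 => reval s e1 / reval s e2
  | RSqrt e1 => Num.sqrt (reval s e1)
  | RExp e1 => expR (reval s e1)
  | RLn e1 => ln (reval s e1)
  end.

Definition beval s (b : bexpr) : bool :=
  match b with
  | ILe e1 e2 => (ieval s e1 <= ieval s e2)%N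
  | RLe e1 e2 => reval s e1 <= reval s e2
  end.

(* Evaluating an expression costs one unit per constant, memory access and
   operation. *)
Fixpoint icost (e : iexpr) : nat :=
  match e with
  | IConst _ | IVar _ => 1
  | IAdd e1 e2 | ISub e1 e2 | IMul e1 e2 => (icost e1 + icost e2).+1
  end.

Fixpoint rcost (e : rexpr) : nat :=
  match e with
  | RNat e1 | RGet _ e1 => (icost e1).+1
  | RAdd e1 e2 | RSub e1 e2 | RMul e1 e2 | RDiv e1 e2 =>
      (rcost e1 + rcost e2).+1
  | RSqrt e1 | RExp e1 | RLn e1 => (rcost e1).+1
  end.

Definition bcost (b : bexpr) : nat :=
  match b with
  | ILe e1 e2 => (icost e1 + icost e2).+1
  | RLe e1 e2 => (rcost e1 + rcost e2).+1
  end.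

(* Final state, and number of elementary steps. *)
Fixpoint run w (c : cmd) s : state R * nat :=
  match c with
  | Skip => (s, 1)
  | ISet x e => (set_ireg s x (ieval s e), (icost e).+1)
  | RSet a e z =>
      (set_rmem s a (ieval s e) (reval s z), (icost e + rcost z).+1)
  | DrawU a e =>
      (next_draw (set_rmem s a (ieval s e) (tape_U w (draws s))), (icost e).+1)
  | DrawN a e =>
      (next_draw (set_rmem s a (ieval s e) (tape_N w (draws s))), (icost e).+1)
  | Seq c1 c2 =>
      let: (s1, n1) := run w c1 s in
      let: (s2, n2) := run w c2 s1 in (s2, n1 + n2)%N
  | If b c1 c2 =>
      let: (s1, n1) := run w (if beval s b then c1 else c2) s in
      (s1, bcost b + n1)%N
  | For x e c1 =>
      iteri (ieval s e)
        (fun k sn =>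
           let: (s1, n1) := run w c1 (set_ireg sn.1 x k) in
           (s1, (sn.2 + n1).+1))
        (s, (icost e).+1)
  end.

End Machine.

(* Online execution.  The same program is run once per round, on the state left
   by the previous round.  Before each round the machine finds v_t in array 0,
   and after it u_t is read off array 1.  Initially registers 0, 1, 2 hold
   r, m, T, array 2 holds delta at index 0, and everything else is 0. *)

Definition init_state (R : realType) (r m T : nat) (delta : R) : state R :=
  State (nth 0%N [:: r; m; T])
    (fun a i => if (a == 2) && (i == 0)%N then delta else 0) 0.

Definition load (R : realType) (m : nat) (x : 'rV[R]_m) (s : state R) : state R :=
  State (ireg s)
    (fun a i => if a == 0%N then
                  (if insub i is Some j then x ord0 j else 0)
                else rmem s a i)
    (draws s).

(* Rounds are numbered from 0: [state_before t] is the state at the start of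
   round t, so it depends on v 0, ..., v t.-1 only. *)
Fixpoint state_before (R : realType) (r m T : nat) (delta : R) (alg : cmd)
    (w : tape R) (v : nat -> 'rV[R]_m) (t : nat) : state R :=
  if t is t'.+1 then
    (run w alg (load (v t') (state_before r T delta alg w v t'))).1
  else init_state r m T delta.

Definition round (R : realType) (r m T : nat) (delta : R) (alg : cmd)
    (w : tape R) (v : nat -> 'rV[R]_m) (t : nat) : state R * nat :=
  run w alg (load (v t) (state_before r T delta alg w v t)).

Definition output (R : realType) (r m T : nat) (delta : R) (alg : cmd)
    (w : tape R) (v : nat -> 'rV[R]_m) (t : nat) : 'rV[R]_r :=
  \row_(j < r) rmem (round r T delta alg w v t).1 1 j.

Definition round_time (R : realType) (r m T : nat) (delta : R) (alg : cmd)
    (w : tape R) (v : nat -> 'rV[R]_m) (t : nat) : nat :=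
  (round r T delta alg w v t).2.

(* Main.v *)
(* Only the first two coordinates of the u_t are used.  The program keeps the
   2 x m matrix W_t = W_0 + sum_(s < t) u_s v_s^T, where W_0 has i.i.d. N(0, 1)
   entries.  With W = W_t, v = v_t and X = W v / |v|, a planar Gaussian, it picks a unit vector
   u, depending on X and |v| only, such that X |-> X + |v| u preserves the planar
   Gaussian measure; hence W |-> W + u v^T preserves the law of W.  Such a u exists
   because two circles of radii p and p' carry points at distance |v| as soon as
   |p - p'| <= |v| <= p + p': for p >= |v| one rotates (p' = p), and for p < |v| one
   takes for p |-> p' the map of [0, |v|) that reverses the law of |X|, which meets
   the triangle inequalities since 1 - exp(- p^2 / 2) is superadditive on p + q <= 1.
   So every column of every W_t is a standard planar Gaussian, and with probability
   1 - delta all columns of W_t - W_0 have norm O(sqrt(log(mT/delta))).  Finally the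
   coordinates of sum_s g_s v_s are linear forms in a two-dimensional Gaussian, so
   their maximum is at most the sum of two of them (an Auerbach basis), with no
   further logarithm. *)

From HB Require Import structures.
Require Import Defs.
From mathcomp Require Import measurable_realfun ring lra zify.

Set Implicit Arguments.
Unset Strict Implicit.
Unset Printing Implicit Defensive.

Local Open Scope classical_set_scope.
Local Open Scope ring_scope.

(** * Lebesgue measure on the plane *)

(** Prescribing the new modulus leaves [u] determined up to a reflection, so everything lies in the
    choice of p |-> p'. A rotation moves a point by at most 2p, too little near the origin; there p'
    must be close to |v|, and reversal is the natural law-preserving map that sends 0 to |v|. The
    bound |v| <= 1 enters through superadditivity.

    All randomness sits in W_0. As the v_t are fixed in advance, each round is a deterministic map
    of W, whose invariance is checked for one constant vector; induction on t gives the law of W_t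
    without any martingale argument. The W_t of different rounds are dependent, but a union bound
    asks only for the law of single entries.

    Radii are measured by their squares: areas of discs are linear in them and their Gaussian law is
    exponential. Angles never appear: a uniform direction is that of a second, independent Gaussian,
    and rotation invariance replaces the polar change of variables. A general v is brought onto a
    coordinate axis by rotating pairs of columns, which preserves both the law of W and the dot
    products that [steer] reads. *)

Section density.
Import HBNNSimple.
Context d (T : measurableType d) (R : realType).
Variables (mu nu : {measure set T -> \bar R}) (h : T -> R).
Hypothesis mh : measurable_fun setT h.
Hypothesis h0 : forall x, 0 <= h x.
Hypothesis nuE : forall A, measurable A -> nu A = (\int[mu]_(x in A) (h x)%:E)%E.

Local Open Scope ereal_scope.

(** Indicators satisfy this by [nuE]; linearity and monotone convergence do the rest, with no
    integrability assumed. It serves for normal laws and for the image of plane Lebesgue measure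
    under the squared norm. *)
Lemma ge0_integral_density (f : T -> \bar R) : measurable_fun setT f ->
  (forall x, 0 <= f x) ->
  \int[nu]_x f x = \int[mu]_x (f x * (h x)%:E).
Proof.
move=> mf f0.
pose g := nnsfun_approx measurableT mf.
have gf x : EFin (g n x) @[n --> \oo] --> f x by exact: cvg_nnsfun_approx.
have ndg x : {homo g^~ x : a b / (a <= b)%N >-> (a <= b)%R}.
  by move=> a b ab; exact/lefP/nd_nnsfun_approx.
have mhE : measurable_fun setT (EFin \o h) by exact/measurable_EFinP.
have mg n : measurable_fun setT (EFin \o g n) by exact/measurable_EFinP.
transitivity (limn (fun n => \int[nu]_x (g n x)%:E)).
  rewrite -monotone_convergence//.
  - by apply: eq_integral => x _; apply/esym/cvg_lim.
  - by move=> n x _; rewrite lee_fin.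
  - by move=> x _ a b ab; rewrite lee_fin ndg.
transitivity (limn (fun n => \int[mu]_x ((g n x)%:E * (h x)%:E))); last first.
  rewrite -monotone_convergence//.
  - apply: eq_integral => x _; apply/cvg_lim => //.
    by apply: cvgeZr.
  - by move=> n; apply: emeasurable_funM => //; exact: mg.
  - by move=> n x _; rewrite mule_ge0// lee_fin.
  - by move=> x _ a b ab; rewrite lee_wpmul2r// lee_fin// ndg.
congr (limn _); apply/funext => n.
have pr r x : 0 <= (r * \1_(g n @^-1` [set r]) x)%:E by rewrite EFinM nnfun_muleindic_ge0.
have mi r : measurable_fun setT (fun x => (r * \1_(g n @^-1` [set r]) x)%:E).
  by apply/measurable_EFinP/measurable_funM.
under eq_integral do rewrite fimfunE -fsumEFin//.
rewrite ge0_integral_fsum//.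
under [RHS]eq_integral.
  move=> x _; rewrite fimfunE -fsumEFin// ge0_mule_fsuml; last by move=> r; exact: pr.
  over.
rewrite ge0_integral_fsum//; last 2 first.
  - by move=> r; apply: emeasurable_funM.
  - by move=> r x _; rewrite mule_ge0 ?lee_fin// -lee_fin.
apply: eq_fsbigr => r rg.
have r0 : (0 <= r)%R by move: rg; rewrite inE/= => -[x _ <-].
have mA : measurable (g n @^-1` [set r]) by exact: measurable_funPTI.
under eq_integral do rewrite EFinM.
rewrite ge0_integralZl//.
2: by apply/measurable_EFinP; exact: measurable_indic.
rewrite integral_indic// setIT nuE//.
under [RHS]eq_integral do rewrite EFinM -muleA.
rewrite ge0_integralZl//; last 2 first.
  - by apply: emeasurable_funM => //; exact/measurable_EFinP.
  - by move=> x _; rewrite mule_ge0 ?lee_fin.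
congr (_ * _); rewrite [LHS]integral_mkcond; apply: eq_integral => x _.
rewrite patchE indicE; case: ifPn => _; [by rewrite mul1e|by rewrite mul0e].
Qed.

End density.

Definition push_measure d d' (T1 : measurableType d) (T2 : measurableType d')
    (R : realType) (m : {measure set T1 -> \bar R}) (f : T1 -> T2)
    (mf : measurable_fun setT f) : {measure set T2 -> \bar R} :=
  measure_function_pushforward__canonical__measure_function_Measure m mf.

Section lebesgue_affine.
Variable R : realType.
Notation mR := (measurableTypeR R).
Notation lam := (@lebesgue_measure R).
Local Open Scope ereal_scope.

(** [k] times the image measure agrees with Lebesgue measure on half-open intervals, hence
    everywhere by uniqueness. *)
Lemma lebesgue_scale (k c : R) (A : set R) : (0 < k)%R -> measurable A ->
  lam ((fun x => k * x + c)%R @^-1` A) = k^-1%:E * lam A.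
Proof.
move=> k0 mA.
have mf : measurable_fun [set: mR] (fun x : mR => (k * x + c)%R : mR).
  by apply: measurable_funD => //; apply: measurable_funM.
have kk : (0 <= k)%R by exact: ltW.
pose nu : {measure set mR -> \bar R} := mscale (NngNum kk) (push_measure lam mf).
have -> : lam A = nu A.
  apply: lebesgue_measure_unique => // _ [[a b] _ <-] /=.
  rewrite /nu /mscale/= /pushforward/=.
  have -> : (fun x => k * x + c)%R @^-1` [set` `]a, b]] =
      [set` `](a - c) / k, (b - c) / k]]%R.
    apply/seteqP; split => x /=; rewrite !in_itv/= ltr_pdivrMr// ler_pdivlMr//;
    by rewrite ltrBlDr lerBrDr ![(x * k)%R]mulrC.
  rewrite !lebesgue_measure_itv/= !lte_fin ltr_pM2r ?invr_gt0// ltrD2r.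
  case: ifPn => _; last by rewrite mule0.
  rewrite -EFinM -EFinB; congr (_%:E); field; exact: lt0r_neq0.
by rewrite /nu /mscale/= muleA -EFinM mulVf ?mul1e// gt_eqF.
Qed.

Lemma ge0_integral_affine (k c : R) (f : R -> \bar R) : (0 < k)%R ->
  measurable_fun setT f -> (forall x, 0 <= f x) ->
  \int[lam]_x f (k * x + c)%R = k^-1%:E * \int[lam]_x f x.
Proof.
move=> k0 mf f0.
have mg : measurable_fun [set: mR] (fun x : mR => (k * x + c)%R : mR).
  by apply: measurable_funD => //; apply: measurable_funM.
have kk : (0 <= k^-1)%R by rewrite invr_ge0 ltW.
transitivity (\int[push_measure lam mg]_x f x).
  by rewrite ge0_integral_pushforward.
transitivity (\int[mscale (NngNum kk) lam]_x f x).
  apply: eq_measure_integral => A mA _; exact: lebesgue_scale.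
by rewrite ge0_integral_mscale.
Qed.

End lebesgue_affine.

Section plane_lebesgue.
Variable R : realType.
Notation mR := (measurableTypeR R).
Notation lam := (@lebesgue_measure R).
Local Open Scope ereal_scope.
Implicit Type f : mR * mR -> \bar R.

(** For fixed [z.2] a shear is a translation of a line. Shears generate the rotations, so rotation
    invariance needs no Jacobian. *)
Lemma integral_shear1 f (k : R) : measurable_fun setT f -> (forall z, 0 <= f z) ->
  \int[lam \x lam]_z f (z.1 + k * z.2, z.2)%R = \int[lam \x lam]_z f z.
Proof.
move=> mf f0.
have mg : measurable_fun setT (fun z : mR * mR => (z.1 + k * z.2, z.2)%R : mR * mR).
  apply: measurable_fun_pair => //; apply: measurable_funD => //.
  by apply: measurable_funM.
rewrite fubini_tonelli2//; last exact: (measurableT_comp mf mg).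
rewrite [RHS]fubini_tonelli2//.
apply: eq_integral => y _; rewrite /fubini_G/=.
have := @ge0_integral_affine R 1 (k * y)%R (fun x => f (x, y)) ltr01.
rewrite invr1 mul1e => <- //.
- by apply: eq_integral => x _; rewrite mul1r.
- exact: measurable_fun_pair1.
Qed.

Lemma integral_shear2 f (k : R) : measurable_fun setT f -> (forall z, 0 <= f z) ->
  \int[lam \x lam]_z f (z.1, z.2 + k * z.1)%R = \int[lam \x lam]_z f z.
Proof.
move=> mf f0.
have mg : measurable_fun setT (fun z : mR * mR => (z.1, z.2 + k * z.1)%R : mR * mR).
  apply: measurable_fun_pair => //; apply: measurable_funD => //.
  by apply: measurable_funM.
rewrite fubini_tonelli1//; last exact: (measurableT_comp mf mg).
rewrite [RHS]fubini_tonelli1//.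
apply: eq_integral => x _; rewrite /fubini_F/=.
have := @ge0_integral_affine R 1 (k * x)%R (fun y => f (x, y)) ltr01.
rewrite invr1 mul1e => <- //.
- by apply: eq_integral => y _; rewrite mul1r.
- exact: measurable_fun_pair2.
Qed.

Lemma integral_scale2 f (k : R) : (0 < k)%R ->
  measurable_fun setT f -> (forall z, 0 <= f z) ->
  \int[lam \x lam]_z f (k * z.1, k * z.2)%R =
  (k ^- 2)%:E * \int[lam \x lam]_z f z.
Proof.
move=> k0 mf f0.
have mg : measurable_fun setT (fun z : mR * mR => (k * z.1, k * z.2)%R : mR * mR).
  by apply: measurable_fun_pair => //; apply: measurable_funM.
rewrite fubini_tonelli1//; last exact: (measurableT_comp mf mg).
rewrite [in RHS]fubini_tonelli1//.
have kV : 0 <= (k^-1)%:E by rewrite lee_fin invr_ge0 ltW.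
have mF : measurable_fun setT (fubini_F lam f).
  exact: measurable_fun_fubini_tonelli_F.
have F0 x : 0 <= fubini_F lam f x by exact: integral_ge0.
transitivity (\int[lam]_x (k^-1%:E * fubini_F lam f (k * x)%R)).
  apply: eq_integral => x _; rewrite /fubini_F/=.
  rewrite -(@ge0_integral_affine R k 0 (fun y => f (k * x, y))%R)//.
    by apply: eq_integral => y _; rewrite addr0.
  exact: measurable_fun_pair2.
have mFk : measurable_fun setT (fun x : mR => fubini_F lam f (k * x)%R).
  by apply: (measurableT_comp mF); exact: measurable_funM.
rewrite (ge0_integralZl lam measurableT mFk _ kV) => [|x _]; last exact: F0.
have -> : (k ^- 2 = k^-1 * k^-1)%R by rewrite -invfM expr2.
rewrite EFinM -muleA; congr (_ * _).
rewrite -(@ge0_integral_affine R k 0 (fubini_F lam f))//.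
by apply: eq_integral => y _; rewrite addr0.
Qed.

Definition rotate (c s : R) (z : R * R) : R * R :=
  (c * z.1 - s * z.2, s * z.1 + c * z.2)%R.

Lemma measurable_rotate c s :
  measurable_fun setT (rotate c s : mR * mR -> mR * mR).
Proof.
apply: measurable_fun_pair; [apply: measurable_funB|apply: measurable_funD];
  exact: measurable_funM.
Qed.

(** A rotation is a product of three shears: along the first axis by [t], minus the tangent of the
    half-angle, along the second by [s], and along the first by [t] again. *)
Lemma integral_rotate f (c s : R) : (c ^+ 2 + s ^+ 2 = 1)%R ->
  measurable_fun setT f -> (forall z, 0 <= f z) ->
  \int[lam \x lam]_z f (rotate c s z) = \int[lam \x lam]_z f z.
Proof.
(* The half-turn, where the denominator [1 + c] vanishes, is the square of a quarter-turn. *)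
wlog c1 : c s f / (c != -1)%R => [wl|] cs mf f0.
  have [cN1|] := eqVneq c (-1)%R; last by move=> c1; exact: wl.
  have s0 : s = 0%R.
    by apply/eqP; rewrite -sqrf_eq0; apply/eqP; move: cs; rewrite cN1; lra.
  have N01 : (0 != -1 :> R)%R by rewrite eq_sym oppr_eq0 oner_eq0.
  have e01 : (0 ^+ 2 + 1 ^+ 2 = 1 :> R)%R by rewrite expr0n expr1n add0r.
  rewrite -(wl 0%R 1%R f N01 e01 mf f0).
  rewrite -(wl 0%R 1%R (fun z => f (rotate 0 1 z)) N01 e01 _ _)//; last first.
    exact: (measurableT_comp mf (measurable_rotate _ _)).
  by apply: eq_integral => z _; congr f; rewrite /rotate /= cN1 s0; congr pair; ring.
have c10 : (1 + c != 0)%R by rewrite addrC addr_eq0.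
set t := (- (s / (1 + c)))%R.
have mf1 : measurable_fun setT (fun z : mR * mR => f (z.1 + t * z.2, z.2)%R).
  apply: (measurableT_comp mf); apply: measurable_fun_pair => //.
  by apply: measurable_funD => //; apply: measurable_funM.
have mf2 : measurable_fun setT
    (fun z : mR * mR => f (z.1 + t * (z.2 + s * z.1), z.2 + s * z.1)%R).
  apply: (measurableT_comp mf); apply: measurable_fun_pair => //.
    apply: measurable_funD => //; apply: measurable_funM => //.
    by apply: measurable_funD => //; apply: measurable_funM.
  by apply: measurable_funD => //; apply: measurable_funM.
rewrite -(integral_shear1 t mf f0) -(integral_shear2 s mf1)//.
rewrite -(integral_shear1 t mf2)//.
apply: eq_integral => z _; congr f; rewrite /rotate/=.
have e : (s ^+ 2 = (1 - c) * (1 + c))%R by rewrite -[X in (X - c)%R]cs; move: cs; nra.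
have ec : (s / (1 + c) * s = 1 - c)%R by rewrite mulrAC -expr2 e mulfK.
congr pair; rewrite /t.
  transitivity ((1 - (s / (1 + c) * s)) * z.1 -
    (s / (1 + c) * (2 - (s / (1 + c) * s))) * z.2)%R; last by ring.
  rewrite ec; congr (_ * _ - _ * _)%R; first by ring.
  by field.
transitivity (s * z.1 + (1 - (s / (1 + c) * s)) * z.2)%R; last by ring.
by rewrite ec; ring.
Qed.

End plane_lebesgue.

(** * The planar Gaussian measure and its radial law *)

Lemma integral_indicT d (T : measurableType d) (R : realType)
    (mu : {measure set T -> \bar R}) (A : set T) : measurable A ->
  (\int[mu]_x (\1_A x)%:E = mu A)%E.
Proof. by move=> mA; rewrite integral_indic// setIT. Qed.

(* Packaged, so that Fubini and the like do not unfold the product measure. *)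
Definition gauss2 (R : realType) :
    probability (measurableTypeR R * measurableTypeR R)%type R :=
  (normal_prob 0 1 \x normal_prob 0 1)%E.

Section gauss_plane.
Variable R : realType.
Notation mR := (measurableTypeR R).
Notation lam := (@lebesgue_measure R).
Notation N := (normal_prob (0 : R) 1).
Notation G := (gauss2 R).
Notation peak := (normal_peak (1 : R)).
Local Open Scope ereal_scope.

Definition nsq (z : R * R) : R := (z.1 ^+ 2 + z.2 ^+ 2)%R.

Lemma nsq_ge0 z : (0 <= nsq z)%R.
Proof. by rewrite addr_ge0// sqr_ge0. Qed.

Lemma measurable_nsq : measurable_fun setT (nsq : mR * mR -> mR).
Proof. by apply: measurable_funD; apply: measurable_funX. Qed.

Let dens (t : R) : R := (peak ^+ 2 * expR (- t / 2))%R.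

Lemma measurable_dens : measurable_fun setT dens.
Proof.
apply: measurable_funM => //; apply: measurableT_comp => //.
exact: measurable_funM.
Qed.

Lemma measurable_dens_nsq :
  measurable_fun setT (fun z : mR * mR => (dens (nsq z))%:E).
Proof.
apply/measurable_EFinP; exact: (measurableT_comp measurable_dens measurable_nsq).
Qed.

Lemma dens_ge0 t : (0 <= dens t)%R.
Proof. by rewrite mulr_ge0// ?expR_ge0// exprn_ge0// normal_peak_ge0. Qed.

Lemma normal_pdf01 (x : R) : normal_pdf 0 1 x = (peak * expR (- x ^+ 2 / 2))%R.
Proof. by rewrite normal_pdfE ?oner_eq0// /normal_fun subr0 expr1n. Qed.

Lemma densE (x y : R) :
  (normal_pdf 0 1 x * normal_pdf 0 1 y = dens (nsq (x, y)))%R.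
Proof.
rewrite !normal_pdf01 /dens /nsq/= mulrACA -expRD; congr (_ * expR _)%R.
by rewrite -mulrDl opprD.
Qed.

Lemma integral_normal01 (f : R -> \bar R) : measurable_fun setT f ->
  (forall x, 0 <= f x) ->
  \int[N]_x f x = \int[lam]_x (f x * (normal_pdf 0 1 x)%:E).
Proof.
move=> mf f0; apply: (@ge0_integral_density _ mR R lam N) => //.
- exact: measurable_normal_pdf.
- exact: normal_pdf_ge0.
Qed.

Lemma integral_gauss_plane (f : mR * mR -> \bar R) : measurable_fun setT f ->
  (forall z, 0 <= f z) ->
  \int[G]_z f z = \int[lam \x lam]_z (f z * (dens (nsq z))%:E).
Proof.
move=> mf f0.
have mg := measurable_dens_nsq.
have mp : measurable_fun setT (fun y : mR => (normal_pdf 0 1 y)%:E).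
  by apply/measurable_EFinP; exact: measurable_normal_pdf.
transitivity (\int[N \x N]_z f z) => //.
rewrite fubini_tonelli1//.
have mF : measurable_fun setT (fubini_F N f) by exact: measurable_fun_fubini_tonelli_F.
rewrite integral_normal01//; last by move=> x; exact: integral_ge0.
rewrite fubini_tonelli1//; first last.
- by move=> z; rewrite mule_ge0// lee_fin dens_ge0.
- exact: emeasurable_funM.
apply: eq_integral => x _; rewrite /fubini_F.
rewrite integral_normal01//; last exact: measurable_fun_pair2.
rewrite muleC -ge0_integralZl//; first last.
- by rewrite lee_fin normal_pdf_ge0.
- by move=> y _; rewrite mule_ge0// lee_fin normal_pdf_ge0.
- by apply: emeasurable_funM => //; exact: measurable_fun_pair2.
apply: eq_integral => y _.
by rewrite muleCA -EFinM densE.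
Qed.

Lemma gauss_rotate (f : mR * mR -> \bar R) (c s : R) : (c ^+ 2 + s ^+ 2 = 1)%R ->
  measurable_fun setT f -> (forall z, 0 <= f z) ->
  \int[G]_z f (rotate c s z) = \int[G]_z f z.
Proof.
move=> cs mf f0.
have mr := @measurable_rotate R c s.
have mfr : measurable_fun setT (fun z => f (rotate c s z)) := measurableT_comp mf mr.
pose F (z : mR * mR) := f z * (dens (nsq z))%:E.
have mF : measurable_fun setT F.
  by apply: emeasurable_funM => //; exact: measurable_dens_nsq.
have F0 z : 0 <= F z by rewrite mule_ge0// lee_fin dens_ge0.
rewrite (integral_gauss_plane mfr)// (integral_gauss_plane mf f0).
transitivity (\int[lam \x lam]_z F (rotate c s z)); last exact: integral_rotate.
apply: eq_integral => z _; congr (_ * (dens _)%:E).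
rewrite /nsq /rotate/=.
transitivity ((c ^+ 2 + s ^+ 2) * (z.1 ^+ 2 + z.2 ^+ 2))%R; last by ring.
by rewrite cs mul1r.
Qed.

Lemma measure_unique_ray (m1 m2 : {measure set mR -> \bar R}) :
  (forall x : R, m1 `]-oo, x[%classic = m2 `]-oo, x[%classic) ->
  (forall x : R, m1 `]-oo, x[%classic < +oo) ->
  forall A, measurable A -> m1 A = m2 A.
Proof.
move=> m12 m1oo A mA.
apply: (@measure_unique _ R mR (@RGenInftyO.G R) (fun n => `]-oo, n%:R[%classic)
  _ _ _ _ m1 m2) => //.
- exact: RGenInftyO.measurableE.
- move=> _ _ [x ->] [y ->]; exists (Num.min x y).
  by apply/seteqP; split => z /=; rewrite !in_itv/= lt_min;
    [case=> -> ->|case/andP].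
- by move=> n; eexists.
- rewrite -subTset => x _; exists (Num.trunc `|x|).+1 => //=.
  rewrite in_itv/=; apply: (le_lt_trans (ler_norm x)).
  exact: truncnS_gt.
- by move=> _ [x ->].
Qed.

(** The area of the unit disc. Its value is never computed, only its finiteness is used. *)
Let disc1 := (lam \x lam)%E [set z : mR * mR | (nsq z < 1)%R].

Lemma measurable_nsq_lt x : measurable [set z : mR * mR | (nsq z < x)%R].
Proof.
have -> : [set z : mR * mR | (nsq z < x)%R] = nsq @^-1` `]-oo, x[%classic.
  by apply/seteqP; split => z /=; rewrite in_itv.
by rewrite -[X in measurable X]setTI; exact: measurable_nsq.
Qed.

Lemma disc1_fin : disc1 \is a fin_num.
Proof.
rewrite ge0_fin_numE ?measure_ge0//.
have sub : [set z : mR * mR | (nsq z < 1)%R] `<=`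
  (`[(-1)%R, 1%R] `*` `[(-1)%R, 1%R])%classic.
  move=> [x y] /=; rewrite /nsq/= => h; rewrite !in_itv/=.
  have := sqr_ge0 x; have := sqr_ge0 y => y2 x2.
  by split; apply/andP; split; nra.
apply: (le_lt_trans (le_measure _ _ _ sub)).
- by rewrite inE; exact: measurable_nsq_lt.
- by rewrite inE; exact: measurableX.
rewrite [ltLHS](_ : _ = lam `[(-1)%R, 1%R]%classic * lam `[(-1)%R, 1%R]%classic).
  2: exact: product_measure1E.
rewrite lebesgue_measure_itv/=.
by case: ifP; rewrite ?mul0e// -EFinB -EFinM ltry.
Qed.

Lemma discE x : (0 < x)%R ->
  (lam \x lam) [set z : mR * mR | (nsq z < x)%R] = disc1 * x%:E.
Proof.
move=> x0.
have s0 : (0 < Num.sqrt x)%R by rewrite sqrtr_gt0.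
have mS := measurable_nsq_lt.
have iE y : \int[lam \x lam]_z (\1_[set z : mR * mR | (nsq z < y)%R] z)%:E =
    (lam \x lam) [set z : mR * mR | (nsq z < y)%R].
  exact: (@integral_indicT _ _ R (lam \x lam)).
have := @integral_scale2 R (fun z => (\1_[set z : mR * mR | (nsq z < x)%R] z)%:E) _ s0.
rewrite iE sqr_sqrtr ?ltW// => e.
have -> : disc1 = x^-1%:E * (lam \x lam) [set z : mR * mR | (nsq z < x)%R].
  rewrite -e//; last exact/measurable_EFinP/measurable_indic.
  rewrite /disc1 -iE.
  apply: eq_integral => z _; congr (_%:E).
  have sE : (nsq (Num.sqrt x * z.1, Num.sqrt x * z.2) = x * nsq z)%R.
    by rewrite /nsq/= !exprMn sqr_sqrtr ?ltW// mulrDr.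
  have key : (x * nsq z < x)%R = (nsq z < 1)%R by rewrite -{2}[x]mulr1 ltr_pM2l.
  rewrite !indicE; congr ((nat_of_bool _)%:R).
  by apply/idP/idP => /set_mem h; apply/mem_set; move: h; rewrite /= sE key.
by rewrite muleAC -EFinM mulVf ?gt_eqF// mul1e.
Qed.

(** By scaling, the area of a disc is linear in its squared radius; half-lines then determine the
    image measure. *)
Lemma nsq_lebesgue (A : set mR) : measurable A ->
  (lam \x lam) (nsq @^-1` A) = disc1 * lam (A `&` `[0%R, +oo[%classic).
Proof.
move=> mA.
have mI : measurable (`[0%R, +oo[%classic : set mR) by exact: measurable_itv.
have d0 : (0 <= fine disc1)%R by rewrite fine_ge0// measure_ge0.
pose m2 : {measure set mR -> \bar R} := mscale (NngNum d0) (mrestr lam mI).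
pose m1 : {measure set mR -> \bar R} := push_measure (lam \x lam) measurable_nsq.
have m1E (x : R) : m1 `]-oo, x[%classic = (lam \x lam) [set z : mR * mR | (nsq z < x)%R].
  by congr ((lam \x lam) _); apply/seteqP; split => z /=; rewrite in_itv.
have m12 : m1 A = m2 A.
  apply: measure_unique_ray => // x; rewrite m1E; last first.
    have [x0|x0] := ltP 0%R x.
      by rewrite discE// -(fineK disc1_fin) -EFinM ltry.
    rewrite (_ : [set z | _] = set0) ?measure0//.
    by rewrite -subset0 => z /= h; have := nsq_ge0 z; rewrite leNgt (lt_le_trans h).
  rewrite /m2/= /mscale/= /mrestr fineK ?disc1_fin//.
  have [x0|x0] := ltP 0%R x.
    rewrite discE//; congr (_ * _).
    rewrite (_ : _ `&` _ = `[0%R, x[%classic).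
      by rewrite lebesgue_measure_itv/= lte_fin x0 oppr0 adde0.
    by apply/seteqP; split => t /=; rewrite !in_itv/= andbT; [case=> -> ->|case/andP].
  rewrite (_ : [set z | _] = set0) ?measure0; last first.
    by rewrite -subset0 => z /= h; have := nsq_ge0 z; rewrite leNgt (lt_le_trans h).
  rewrite (_ : _ `&` _ = set0) ?measure0 ?mule0//.
  rewrite -subset0 => t /=; rewrite !in_itv/= andbT => -[t1 t2].
  by move: t2; rewrite leNgt (lt_le_trans t1).
transitivity (m1 A) => //.
by rewrite m12 /m2/= /mscale/= /mrestr fineK ?disc1_fin.
Qed.

(** The last factor compensates the rate 1/2 in front of the exponential density. *)
Let K := (fine disc1 * (peak ^+ 2 * 2))%R.

Let K0 : (0 <= K)%R.
Proof.
rewrite mulr_ge0 ?fine_ge0 ?measure_ge0//.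
by rewrite mulr_ge0// exprn_ge0// normal_peak_ge0.
Qed.

Lemma nsq_gauss_density (A : set mR) : measurable A ->
  G (nsq @^-1` A) =
  K%:E * \int[lam]_(t in A) (exponential_pdf (2^-1) t)%:E.
Proof.
move=> mA.
have mI : measurable (`[0%R, +oo[%classic : set mR) by exact: measurable_itv.
have mh : measurable_fun setT (fun t : mR => (\1_A t)%:E * (dens t)%:E : \bar R).
  apply: emeasurable_funM; apply/measurable_EFinP => //.
  exact: measurable_dens.
have mnA : measurable (nsq @^-1` A : set (mR * mR)).
  by rewrite -[X in measurable X]setTI; exact: measurable_nsq.
have -> : G (nsq @^-1` A) = \int[G]_z (\1_A (nsq z))%:E.
  have -> : (fun z => (\1_A (nsq z))%:E) = (fun z => (\1_(nsq @^-1` A) z)%:E :> \bar R).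
    apply/funext => z; rewrite !indicE.
    suff -> : (z \in nsq @^-1` A) = (nsq z \in A) by [].
    by apply/idP/idP => /set_mem ?; exact/mem_set.
  exact/esym/(@integral_indicT _ _ R G).
have mi : measurable_fun setT (fun z : mR * mR => (\1_A (nsq z))%:E : \bar R).
  by apply/measurable_EFinP; exact: (measurableT_comp (measurable_indic _) measurable_nsq).
have i0 z : 0 <= (\1_A (nsq z))%:E :> \bar R by rewrite lee_fin.
rewrite (integral_gauss_plane mi i0).
transitivity (\int[push_measure (lam \x lam) measurable_nsq]_t ((\1_A t)%:E * (dens t)%:E)).
  rewrite (ge0_integral_pushforward measurable_nsq _ measurableT mh)//.
  by move=> t _; rewrite mule_ge0 ?lee_fin ?dens_ge0.
rewrite (@ge0_integral_density _ mR R lam _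
  (fun t => fine disc1 * \1_(`[0%R, +oo[%classic) t)%R)//; first last.
- by move=> t; rewrite mule_ge0 ?lee_fin ?dens_ge0.
- move=> B mB; rewrite /push_measure/= /pushforward nsq_lebesgue//.
  under eq_integral do rewrite EFinM.
  rewrite ge0_integralZl//; last by rewrite lee_fin fine_ge0// measure_ge0.
    rewrite integral_indic// fineK ?disc1_fin//; congr (_ * lam _); exact: setIC.
  by apply/measurable_EFinP; exact: measurable_indic.
- by move=> t; rewrite mulr_ge0// fine_ge0// measure_ge0.
- by apply: measurable_funM => //; exact: measurable_indic.
rewrite [in RHS]integral_mkcond -ge0_integralZl//; first last.
- by move=> t _; rewrite patchE; case: ifP => // _; rewrite lee_fin exponential_pdf_ge0.
- apply/(measurable_restrictT _ _).1 => //; apply/measurable_funTS/measurable_EFinP.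
  exact: measurable_exponential_pdf.
apply: eq_integral => t _; rewrite patchE indicE.
case: ifP => _; last by rewrite mul0e mul0e mule0.
rewrite mul1e -!EFinM /exponential_pdf patchE indicE; congr _%:E.
case: ifP => _; last by rewrite !mulr0.
rewrite /K /dens mulr1 (_ : - 2^-1 * t = - t / 2)%R; last by rewrite mulNr mulrC mulNr.
by field.
Qed.

Let tail (x : R) : (0 <= x)%R ->
  G (nsq @^-1` `[x, +oo[%classic) = (K * expR (- x / 2))%:E.
Proof.
move=> x0; rewrite nsq_gauss_density; last exact: measurable_itv.
rewrite EFinM; congr (_ * _).
pose F := fun t : R => (- expR (- 2^-1 * t))%R.
have cE : continuous (fun t : R => expR (- 2^-1 * t)).
  move=> t; apply: continuous_comp; last exact: continuous_expR.
  by apply: cvgM; [exact: cvg_cst|exact: cvg_id].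
rewrite (@ge0_continuous_FTC2y _ _ F _ 0%R).
- by rewrite /F EFinN oppeK add0e; congr (expR _)%:E; rewrite mulNr mulrC mulNr.
- by move=> t _; exact: exponential_pdf_ge0.
- apply: (@continuous_subspaceW R^o _ _ [set` `[0%R, +oo[]).
    by move=> t /=; rewrite !in_itv/= !andbT; exact: le_trans.
  exact: within_continuous_exponential_pdf.
- rewrite -oppr0; apply: cvgN.
  rewrite (_ : (fun x => expR _) =
               (fun z => expR (- z)) \o (fun z => 2^-1 * z)%R); last first.
    by apply: eq_fun => t; rewrite mulNr.
  apply: (@cvg_comp _ _ _ _ _ _ (pinfty_nbhs R)); last exact: cvgr_expR.
  exact: gt0_cvgMry.
- by move=> t _; exact: ex_derive.
- by apply: cvgN; apply/cvg_at_right_filter; exact: cE.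
- move=> t tx; apply: derive1_exponential_pdf; move: tx; rewrite !in_itv/= !andbT.
  exact: le_lt_trans.
Qed.

(** At 0 the tail is the whole plane, so total mass 1 forces the value of the constant. *)
Let K1 : K = 1%R.
Proof.
apply: EFin_inj; have := tail (lexx 0%R); rewrite oppr0 mul0r expR0 mulr1 => <-.
rewrite (_ : _ @^-1` _ = setT); first by rewrite probability_setT.
by apply/seteqP; split => z //= _; rewrite in_itv/= andbT nsq_ge0.
Qed.

Lemma nsq_gauss_tail (x : R) : (0 <= x)%R ->
  G (nsq @^-1` `[x, +oo[%classic) = (expR (- x / 2))%:E.
Proof. by move=> x0; rewrite tail// K1 mul1r. Qed.

Lemma nsq_gauss_set1 (x : R) : G (nsq @^-1` [set x]) = 0.
Proof. by rewrite nsq_gauss_density// integral_set1 mule0. Qed.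

Definition radial : {measure set mR -> \bar R} :=
  push_measure G measurable_nsq.

Lemma radial_tail (x : R) : (0 <= x)%R ->
  radial `[x, +oo[%classic = (expR (- x / 2))%:E.
Proof. exact: nsq_gauss_tail. Qed.

Lemma radial_tail_open (x : R) : (0 <= x)%R ->
  radial `]x, +oo[%classic = (expR (- x / 2))%:E.
Proof.
move=> x0; rewrite -(radial_tail x0).
have -> : `[x, +oo[%classic = [set x] `|` `]x, +oo[%classic by rewrite setU1itv.
have mo : measurable (`]x, +oo[%classic : set mR) by exact: measurable_itv.
have ms : measurable ([set x] : set mR) by exact: measurable_set1.
have d : [set x] `&` `]x, +oo[%classic = set0.
  by rewrite -subset0 => t /= [->]; rewrite in_itv/= ltxx.
rewrite (measureU radial ms mo d).
rewrite [X in _ = X + _](_ : _ = 0); last exact: nsq_gauss_set1.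
by rewrite add0e.
Qed.

Lemma radial_lt0 : radial `]-oo, 0%R[%classic = 0.
Proof.
rewrite /radial/= /pushforward (_ : _ @^-1` _ = set0) ?measure0//.
by rewrite -subset0 => z /=; rewrite in_itv/= ltNge nsq_ge0.
Qed.

Lemma radial_lty A : measurable A -> radial A < +oo.
Proof.
move=> mA; apply: (@le_lt_trans _ _ 1); last exact: ltry.
apply: probability_le1; rewrite -[X in measurable X]setTI; exact: measurable_nsq.
Qed.

(* The squared norm of a planar Gaussian is exponential with rate 1/2; [flip b]
   reverses that law on [0, b). *)
Definition flip (b t : R) : R :=
  if ((0 <= t) && (t < b))%R then (- 2 * ln (1 + expR (- b / 2) - expR (- t / 2)))%R
  else t.

(** [expR (- t / 2)] is the tail of the radial law, hence uniformly distributed under it. In this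
    coordinate reversing [0, b) is the reflection that exchanges 1 and [expR (- b / 2)]. *)
Lemma expR_flip (b t : R) : (0 <= t < b)%R ->
  expR (- flip b t / 2) = (1 + expR (- b / 2) - expR (- t / 2))%R.
Proof.
move=> tb; rewrite /flip tb.
have t0 : (expR (- t / 2) <= 1)%R by rewrite -[leRHS]expR0 ler_expR; case/andP: tb; lra.
have b0 := expR_gt0 (- b / 2).
rewrite (_ : - (- 2 * _) / 2 = ln (1 + expR (- b / 2) - expR (- t / 2)))%R; last by field.
by rewrite lnK// posrE; lra.
Qed.

Lemma flip_itv (b t : R) : (0 <= t < b)%R -> (0 < flip b t <= b)%R.
Proof.
move=> tb; have e := expR_flip tb; case/andP: tb => t0 tb.
have h1 : (expR (- flip b t / 2) < expR (- 0 / 2))%R.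
  rewrite e oppr0 mul0r expR0.
  have : (expR (- b / 2) < expR (- t / 2))%R by rewrite ltr_expR; lra.
  by lra.
have h2 : (expR (- b / 2) <= expR (- flip b t / 2))%R.
  have : (expR (- t / 2) <= 1)%R by rewrite -[leRHS]expR0 ler_expR; lra.
  by rewrite e; lra.
move: h1 h2; rewrite ltr_expR ler_expR => h1 h2; apply/andP; split; lra.
Qed.

Lemma measurable_flip b : measurable_fun setT (flip b : mR -> mR).
Proof.
have mE : measurable_fun setT (fun t : mR => expR (- t / 2)).
  by apply: measurableT_comp => //; exact: measurable_funM.
apply: measurable_fun_ifT => //.
  by apply: measurable_and; [exact: measurable_fun_ler|exact: measurable_fun_ltr].
apply: measurable_funM => //; apply: measurableT_comp => //.
exact: measurable_funB.
Qed.

Lemma radial_flip (b : R) (A : set mR) : measurable A -> (0 < b)%R ->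
  radial (flip b @^-1` A) = radial A.
Proof.
move=> mA b0.
pose m1 : {measure set mR -> \bar R} := push_measure radial (@measurable_flip b).
suff : m1 A = radial A by [].
apply: (measure_unique_ray (m1 := m1) (m2 := radial) _ _ mA) => x; last first.
  by apply: radial_lty; rewrite -[X in measurable X]setTI; exact: measurable_flip.
rewrite /m1/= /pushforward.
have [x0|x0] := leP x 0%R.
  congr (radial _); apply/seteqP; split => t /=; rewrite !in_itv/= => tx.
    move: tx; have [/flip_itv|] := boolP ((0 <= t) && (t < b))%R.
      by move=> /andP[f0 _] fx; have := lt_trans f0 (lt_le_trans fx x0); rewrite ltxx.
    by move=> h; rewrite /flip (negbTE h).
  by rewrite /flip leNgt (lt_le_trans tx x0).
have [xb|bx] := leP x b; last first.
  congr (radial _); apply/seteqP; split => t /=; rewrite !in_itv/= => tx.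
    have [/[dup]/flip_itv _ /andP[_ tb]|] := boolP ((0 <= t) && (t < b))%R.
      exact: lt_trans bx.
    by move=> h; move: tx; rewrite /flip (negbTE h).
  have [/flip_itv/andP[_ fb]|h] := boolP ((0 <= t) && (t < b))%R.
    exact: le_lt_trans bx.
  by rewrite /flip (negbTE h).
(* As [flip b] is decreasing on [0, b), the values below [x] come there from the points above [y].
   The formula is spelled out because at [x = b] it must give 0, whereas [flip b b] is [b]. *)
pose y : R := (- 2 * ln (1 + expR (- b / 2) - expR (- x / 2)))%R.
have Ex : (expR (- x / 2) < 1)%R by rewrite -[ltRHS]expR0 ltr_expR; lra.
have Exb : (expR (- b / 2) <= expR (- x / 2))%R by rewrite ler_expR; lra.
have b0' := expR_gt0 (- b / 2).
have Ey : expR (- y / 2) = (1 + expR (- b / 2) - expR (- x / 2))%R.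
  rewrite (_ : - y / 2 = ln (1 + expR (- b / 2) - expR (- x / 2)))%R.
    2: by rewrite /y; field.
  by rewrite lnK// posrE; lra.
have y0 : (0 <= y)%R.
  have : (expR (- y / 2) <= expR 0)%R by rewrite Ey expR0; lra.
  by rewrite ler_expR; lra.
have yb : (y < b)%R.
  have : (expR (- b / 2) < expR (- y / 2))%R by rewrite Ey; lra.
  by rewrite ltr_expR; lra.
have -> : flip b @^-1` `]-oo, x[%classic =
    (`]-oo, 0%R[ `|` (`]y, +oo[ `\` `[b, +oo[))%classic.
  apply/seteqP; split => t /=; rewrite !in_itv/= !andbT.
    have [t0 tx|t0] := ltP t 0%R; first by left.
    have [tb|bt] := ltP t b; last first.
      rewrite /flip [(t < b)%R]ltNge bt andbF => tx.
      have := le_lt_trans bt (lt_le_trans tx xb).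
      by rewrite ltxx.
    have tb' : (0 <= t < b)%R by rewrite t0.
    move=> fx; right; split; last by [].
    have : (expR (- x / 2) < expR (- flip b t / 2))%R by rewrite ltr_expR; lra.
    rewrite expR_flip// => h.
    have : (expR (- t / 2) < expR (- y / 2))%R by rewrite Ey; lra.
    by rewrite ltr_expR; lra.
  case=> [t0|[yt /negP]]; first by rewrite /flip leNgt t0/=; exact: lt_trans x0.
  rewrite -ltNge => tb.
  have tb' : (0 <= t < b)%R by rewrite tb andbT; exact: le_trans y0 (ltW yt).
  have : (expR (- t / 2) < expR (- y / 2))%R by rewrite ltr_expR; lra.
  rewrite Ey => h.
  have : (expR (- x / 2) < expR (- flip b t / 2))%R by rewrite expR_flip//; lra.
  by rewrite ltr_expR; lra.
change (radial (`]-oo, 0%R[ `|` (`]y, +oo[ `\` `[b, +oo[))%classic =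
  radial `]-oo, x[%classic).
have mi (i : interval R) : measurable ([set` i] : set mR) by exact: measurable_itv.
have mD : measurable (`]y, +oo[ `\` `[b, +oo[ : set mR)%classic by exact: measurableD.
have dj : (`]-oo, 0%R[ `&` (`]y, +oo[ `\` `[b, +oo[) = set0 :> set mR)%classic.
  rewrite -subset0 => t /= [] /[!in_itv]/= t0 [] /[!andbT] yt _.
  by have := lt_trans t0 (le_lt_trans y0 yt); rewrite ltxx.
have bE : (`]y, +oo[ `&` `[b, +oo[ = `[b, +oo[ :> set mR)%classic.
  by apply: setIidr => t /=; rewrite !in_itv/= !andbT; exact: lt_le_trans.
have e1 : radial (`]y, +oo[ `\` `[b, +oo[)%classic =
    (expR (- y / 2))%:E - (expR (- b / 2))%:E.
  rewrite -(radial_tail_open y0) -(radial_tail (ltW b0)).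
  transitivity (radial `]y, +oo[%classic - radial (`]y, +oo[ `&` `[b, +oo[)%classic).
    by apply: measureD; [exact: mi|exact: mi|apply: radial_lty; exact: mi].
  by rewrite bE.
have e2 : radial `]-oo, x[%classic = 1 - (expR (- x / 2))%:E.
  rewrite -(radial_tail (ltW x0)) -setCitvr.
  apply: (@probability_setC _ _ R G (nsq @^-1` `[x, +oo[%classic)).
  by rewrite -[X in measurable X]setTI; exact: measurable_nsq.
rewrite e2; transitivity (0 + ((expR (- y / 2))%:E - (expR (- b / 2))%:E)).
  by rewrite -radial_lt0 -e1; apply: measureU => //; exact: mi.
by rewrite add0e Ey -!EFinB; congr _%:E; ring.
Qed.

End gauss_plane.

(** * A Gaussian-preserving map with constant displacement *)

Section geometry.
Variable R : realType.
Implicit Types p q b t : R.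

(** With P and Q the two terms on the right and Z = exp(-pq), the claim reads (1 - P)(1 - Q) <= PQ(1
    - Z). Since P >= 1/2, 1 - P <= p^2 / 2 <= P p^2, and likewise for Q; so it suffices that (pq)^2
    <= 1 - Z, which follows from Z <= 1 / (1 + pq) and pq <= 1/4. *)
Lemma expR_superadd p q : 0 <= p -> 0 <= q -> p + q <= 1 ->
  1 + expR (- (p + q) ^+ 2 / 2) <= expR (- p ^+ 2 / 2) + expR (- q ^+ 2 / 2).
Proof.
move=> p0 q0 pq.
have -> : - (p + q) ^+ 2 / 2 = (- p ^+ 2 / 2 + - q ^+ 2 / 2) - p * q by field.
rewrite !expRD.
set P := expR (- p ^+ 2 / 2); set Q := expR (- q ^+ 2 / 2).
set Z := expR (- (p * q)).
have z0 : 0 <= p * q by exact: mulr_ge0.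
have z1 : p * q <= 1 / 4.
  have := sqr_ge0 (p - q); have : (p + q) ^+ 2 <= 1 by rewrite expr_le1//; lra.
  by lra.
have hP : 1 - p ^+ 2 / 2 <= P.
  by rewrite /P; have := expR_ge1Dx (- p ^+ 2 / 2); lra.
have hQ : 1 - q ^+ 2 / 2 <= Q.
  by rewrite /Q; have := expR_ge1Dx (- q ^+ 2 / 2); lra.
have P1 : P <= 1 by rewrite /P -[leRHS]expR0 ler_expR; have := sqr_ge0 p; lra.
have Q1 : Q <= 1 by rewrite /Q -[leRHS]expR0 ler_expR; have := sqr_ge0 q; lra.
have p2 : p ^+ 2 <= 1 by rewrite expr_le1//; lra.
have q2 : q ^+ 2 <= 1 by rewrite expr_le1//; lra.
have hP' : 1 - P <= P * p ^+ 2.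
  have : (1 / 2) * p ^+ 2 <= P * p ^+ 2 by apply: ler_wpM2r; [exact: sqr_ge0|lra].
  by lra.
have hQ' : 1 - Q <= Q * q ^+ 2.
  have : (1 / 2) * q ^+ 2 <= Q * q ^+ 2 by apply: ler_wpM2r; [exact: sqr_ge0|lra].
  by lra.
have hZ : Z * (1 + p * q) <= 1.
  rewrite /Z expRN mulrC ler_pdivrMr ?expR_gt0// mul1r; exact: expR_ge1Dx.
have hZ' : (p * q) ^+ 2 <= 1 - Z.
  have Z0 : 0 <= Z by exact: expR_ge0.
  suff : Z <= 1 - (p * q) ^+ 2 by lra.
  have : (1 - (p * q) ^+ 2) * (1 + p * q) >= 1 by nra.
  move=> h; rewrite -(@ler_pM2r _ (1 + p * q)); last by lra.
  by lra.
have PQ0 : 0 <= P * Q by rewrite mulr_ge0 ?expR_ge0.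
have h1 : (1 - P) * (1 - Q) <= (P * p ^+ 2) * (Q * q ^+ 2).
  by apply: ler_pM => //; lra.
have h2 : P * Q * (p * q) ^+ 2 <= P * Q * (1 - Z) by exact: ler_wpM2l.
have e : (P * p ^+ 2) * (Q * q ^+ 2) = P * Q * (p * q) ^+ 2 by ring.
rewrite e in h1; nra.
Qed.

(** By the law of cosines this says that a triangle with squared sides [b], [t] and [flip b t]
    exists. For t < b the lower bound on the new radius is [expR_superadd] at sqrt t and sqrt b -
    sqrt t, whose sum is at most 1; the upper bound is just [flip b t <= b]. *)
Lemma flip_triangle b t : 0 < b <= 1 -> 0 < t ->
  (flip b t - t - b) ^+ 2 <= 4 * b * t.
Proof.
move=> /andP[b0 b1] t0; have [bt|tb] := leP b t.
  by rewrite /flip [(t < b)%R]ltNge bt andbF; nra.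
have tb' : 0 <= t < b by rewrite ltW.
have /andP[f0 fb] := flip_itv tb'; have := expR_flip tb'.
set t' := flip b t in f0 fb *; move=> e.
set a := Num.sqrt b; set p := Num.sqrt t.
have a0 : 0 <= a by exact: sqrtr_ge0.
have p0 : 0 <= p by exact: sqrtr_ge0.
have aE : b = a ^+ 2 by rewrite sqr_sqrtr// ltW.
have pE : t = p ^+ 2 by rewrite sqr_sqrtr// ltW.
have pa : p <= a by rewrite ler_sqrt// ltW.
have a1 : a <= 1 by rewrite -sqrtr1 ler_sqrt.
have := @expR_superadd p (a - p) p0.
rewrite subr_ge0 pa => /(_ isT); rewrite addrC subrK a1 => /(_ isT).
rewrite -aE -pE => h.
have : expR (- t' / 2) <= expR (- (a - p) ^+ 2 / 2) by rewrite e; lra.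
rewrite ler_expR => lo.
have ap0 : 0 <= a * p by exact: mulr_ge0.
have ub : t' - t - b <= 2 * (a * p) by rewrite aE pE in fb *; nra.
have lb : - (2 * (a * p)) <= t' - t - b by rewrite aE pE; lra.
have -> : 4 * b * t = (2 * (a * p)) ^+ 2 by rewrite aE pE; ring.
by rewrite -subr_ge0 subr_sqr mulr_ge0//; lra.
Qed.

End geometry.

(** Inversion is discontinuous at 0, so it is written piecewise through [expR] and [ln], with the
    value 0 at 0. *)
Lemma measurable_invr (R : realType) :
  measurable_fun [set: R] (fun t : R => t^-1).
Proof.
have -> : (fun t : R => t^-1) = (fun t => if 0 < t then expR (- ln t)
    else if t < 0 then - expR (- ln (- t)) else 0).
  apply/funext => t; case: (ltgtP t 0) => [t0|t0|->]; last by rewrite invr0.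
    by rewrite expRN lnK ?posrE ?oppr_gt0// invrN opprK.
  by rewrite expRN lnK.
have mlt : measurable_fun [set: R] (fun t : R => 0 < t) by exact: measurable_fun_ltr.
have mgt : measurable_fun [set: R] (fun t : R => t < 0) by exact: measurable_fun_ltr.
have mN : measurable_fun [set: R] (fun t : R => - t) by exact: oppr_measurable.
have mE : measurable_fun [set: R] (fun t : R => expR (- ln t)).
  apply: (measurableT_comp (@measurable_expR R)).
  exact: (measurableT_comp mN (@measurable_ln R)).
apply: measurable_fun_ifT => //; apply: measurable_fun_ifT => //.
exact: (measurableT_comp mN (measurableT_comp mE mN)).
Qed.

Lemma measurable_sqrtr (R : realType) : measurable_fun [set: R] (@Num.sqrt R).
Proof. by apply: continuous_measurable_fun; exact: sqrt_continuous. Qed.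

Section turn.
Variable R : realType.
Implicit Types (c b t : R) (z : R * R).

(* Multiplying a complex number of squared modulus t by
   1 + turn_re b t + i turn_im b t moves it by sqrt b, and changes its squared
   modulus to flip b t. *)
Definition turn_re b t : R := (flip b t - t - b) / (2 * t).
Definition turn_im b t : R := Num.sqrt (b / t - turn_re b t ^+ 2).

(** The triangle inequality makes the radicand of [turn_im] nonnegative, so the square root does not
    truncate it to 0. *)
Lemma turn_normed b t : 0 < b <= 1 -> 0 < t ->
  turn_re b t ^+ 2 + turn_im b t ^+ 2 = b / t.
Proof.
move=> b01 t0; rewrite /turn_im sqr_sqrtr; first by rewrite addrC subrK.
rewrite subr_ge0 /turn_re expr_div_n ler_pdivrMr ?exprn_gt0 ?mulr_gt0//.
have -> : b / t * (2 * t) ^+ 2 = 4 * b * t by field; exact: lt0r_neq0.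
exact: flip_triangle.
Qed.

Lemma turn_flip b t : 0 < b <= 1 -> 0 < t ->
  (1 + turn_re b t) ^+ 2 + turn_im b t ^+ 2 = flip b t / t.
Proof.
move=> b01 t0; have e := turn_normed b01 t0.
have -> : (1 + turn_re b t) ^+ 2 + turn_im b t ^+ 2 =
  1 + 2 * turn_re b t + (turn_re b t ^+ 2 + turn_im b t ^+ 2) by ring.
by rewrite e /turn_re; field; exact: lt0r_neq0.
Qed.

(** [rotate] is complex multiplication, here by a number that need not have modulus 1. The origin is
    a null set; the displacement chosen there matches the default [(1, 0)] of [steer]. *)
Definition hop c z : R * R :=
  if nsq z <= 0 then (z.1 + c, z.2) else
  rotate (1 + turn_re (c ^+ 2) (nsq z)) (turn_im (c ^+ 2) (nsq z)) z.

Lemma measurable_hop c :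
  measurable_fun setT (hop c : measurableTypeR R * measurableTypeR R ->
                               measurableTypeR R * measurableTypeR R).
Proof.
have mn := @measurable_nsq R.
have mf := measurableT_comp (measurable_flip (c ^+ 2)) mn.
have mi : measurable_fun setT (fun t : measurableTypeR R => t^-1).
  exact: measurable_invr.
have mV := measurableT_comp mi mn.
have m2V := measurableT_comp mi (measurable_funM (measurable_cst (2 : R)) mn).
have mre : measurable_fun setT
    (fun z : measurableTypeR R * measurableTypeR R => turn_re (c ^+ 2) (nsq z)).
  apply: measurable_funM; last exact: m2V.
  by apply: measurable_funB => //; exact: measurable_funB.
have mim : measurable_fun setT
    (fun z : measurableTypeR R * measurableTypeR R => turn_im (c ^+ 2) (nsq z)).
  apply: (measurableT_comp (@measurable_sqrtr R)).
  by apply: measurable_funB; [exact: measurable_funM|exact: measurable_funX].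
apply: measurable_fun_ifT.
- exact: measurable_fun_ler.
- by apply: measurable_fun_pair => //; apply: measurable_funD.
- apply: measurable_fun_pair.
    apply: measurable_funB; apply: measurable_funM => //.
    exact: measurable_funD.
  apply: measurable_funD; apply: measurable_funM => //.
  exact: measurable_funD.
Qed.

End turn.

(** * Polar decomposition of the planar Gaussian *)

Section polar.
Variable R : realType.
Notation mR := (measurableTypeR R).
Notation G := (gauss2 R).
Local Open Scope ereal_scope.
Implicit Types (f g : mR * mR -> \bar R) (z w : R * R).

Definition dir z : R * R := (z.1 / Num.sqrt (nsq z), z.2 / Num.sqrt (nsq z))%R.

Definition scale2 (k : R) z : R * R := (k * z.1, k * z.2)%R.

Lemma measurable_dir : measurable_fun setT (dir : mR * mR -> mR * mR).
Proof.
have mi : measurable_fun setT (fun t : mR => (Num.sqrt t)^-1%R).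
  exact: (measurableT_comp (@measurable_invr R) (@measurable_sqrtr R)).
have mV := measurableT_comp mi (@measurable_nsq R).
by apply: measurable_fun_pair; exact: measurable_funM.
Qed.

Lemma nsq_rotate (c s : R) z : nsq (rotate c s z) = ((c ^+ 2 + s ^+ 2) * nsq z)%R.
Proof. by rewrite /nsq /rotate/=; ring. Qed.

Lemma nsq_eq0 z : nsq z = 0%R -> z = (0, 0)%R.
Proof.
case: z => x y; rewrite /nsq/= => /eqP.
by rewrite paddr_eq0 ?sqr_ge0// !sqrf_eq0 => /andP[/eqP -> /eqP ->].
Qed.

Lemma nsq_dir z : (0 < nsq z)%R -> nsq (dir z) = 1%R.
Proof.
move=> z0; rewrite /dir {1}/nsq/= !expr_div_n sqr_sqrtr ?ltW// -mulrDl.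
by rewrite divff// gt_eqF.
Qed.

Lemma dir_rotate (c s : R) z : (c ^+ 2 + s ^+ 2 = 1)%R ->
  dir (rotate c s z) = rotate c s (dir z).
Proof.
move=> cs; rewrite /dir nsq_rotate cs mul1r /rotate/=.
by congr pair; rewrite ?mulrBl ?mulrDl !mulrA.
Qed.

Lemma scale2_dir z : scale2 (Num.sqrt (nsq z)) (dir z) = z.
Proof.
have [z0|] := ltP 0%R (nsq z).
  rewrite /scale2 /dir/=; case: z z0 => x y /= z0.
  by rewrite ![(Num.sqrt _ * _)%R]mulrC !divfK// gt_eqF// sqrtr_gt0.
move=> z0; have /nsq_eq0-> : nsq z = 0%R by apply/eqP; rewrite eq_le z0 nsq_ge0.
by rewrite /scale2 /dir/= mul0r mulr0.
Qed.

Lemma eq_gauss_integral f g : measurable_fun setT f -> measurable_fun setT g ->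
  (forall z, 0 <= f z) -> (forall z, 0 <= g z) ->
  (forall z, (0 < nsq z)%R -> f z = g z) ->
  \int[G]_z f z = \int[G]_z g z.
Proof.
move=> mf mg f0 g0 fg; apply: ge0_ae_eq_integral => //.
exists (@nsq R @^-1` [set 0%R]); split.
- by rewrite -[X in measurable X]setTI; exact: measurable_nsq.
- exact: nsq_gauss_set1.
- move=> z /= h; apply: contrapT => z0; apply: h => _; apply: fg.
  by rewrite lt_neqAle nsq_ge0 andbT eq_sym; apply/eqP.
Qed.

(* Average of f over the circle of squared radius t; the uniform direction is that
   of a Gaussian vector. *)
Definition circ f (t : R) : \bar R :=
  \int[G]_z f (scale2 (Num.sqrt t) (dir z)).

Lemma measurable_circ_integrand f : measurable_fun setT f ->
  measurable_fun setT (fun tz : mR * (mR * mR) => f (scale2 (Num.sqrt tz.1) (dir tz.2))).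
Proof.
move=> mf; apply: (measurableT_comp mf).
have ms : measurable_fun setT (fun tz : mR * (mR * mR) => Num.sqrt tz.1).
  exact: (measurableT_comp (@measurable_sqrtr R) measurable_fst).
have md : measurable_fun setT (fun tz : mR * (mR * mR) => dir tz.2).
  exact: (measurableT_comp measurable_dir measurable_snd).
apply: measurable_fun_pair; apply: measurable_funM => //.
  exact: (measurableT_comp measurable_fst md).
exact: (measurableT_comp measurable_snd md).
Qed.

Lemma measurable_circ f : measurable_fun setT f -> (forall z, 0 <= f z) ->
  measurable_fun setT (circ f : mR -> \bar R).
Proof.
move=> mf f0; have m := measurable_circ_integrand mf.
pose h (tz : mR * (mR * mR)) := f (scale2 (Num.sqrt tz.1) (dir tz.2)).
have -> : circ f = fubini_F G h by [].
have h0 tz : 0 <= h tz by exact: f0.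
exact: (measurable_fun_fubini_tonelli_F h m h0).
Qed.

Lemma circ_ge0 f t : (forall z, 0 <= f z) -> 0 <= circ f t.
Proof. by move=> f0; exact: integral_ge0. Qed.

(** Integrate f(dir(y) x), a complex product, over two independent Gaussians x and y. For fixed y,
    rotation invariance in x gives the left side. For fixed x, the product is |x| dir(x) dir(y), and
    rotation invariance in y removes dir(x), which gives the circle average. *)
Lemma polar f : measurable_fun setT f -> (forall z, 0 <= f z) ->
  \int[G]_z f z = \int[G]_z circ f (nsq z).
Proof.
move=> mf f0.
pose H (p : (mR * mR) * (mR * mR)) := f (rotate (dir p.2).1 (dir p.2).2 p.1).
have mH : measurable_fun setT H.
  apply: (measurableT_comp mf).
  have md : measurable_fun setT (fun p : (mR * mR) * (mR * mR) => dir p.2).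
    exact: (measurableT_comp measurable_dir measurable_snd).
  have md1 := measurableT_comp measurable_fst md.
  have md2 := measurableT_comp measurable_snd md.
  have m1 : measurable_fun setT (fun p : (mR * mR) * (mR * mR) => p.1.1).
    exact: (measurableT_comp measurable_fst measurable_fst).
  have m2 : measurable_fun setT (fun p : (mR * mR) * (mR * mR) => p.1.2).
    exact: (measurableT_comp measurable_snd measurable_fst).
  by apply: measurable_fun_pair; [apply: measurable_funB|apply: measurable_funD];
    exact: measurable_funM.
have H0 p : 0 <= H p by exact: f0.
have := @fubini_tonelli _ _ (mR * mR)%type (mR * mR)%type R G G H mH H0.
have -> : \int[G]_x \int[G]_y H (x, y) = \int[G]_z circ f (nsq z).
  apply: eq_integral => x _; rewrite /H/=.
  have [x0|] := ltP 0%R (nsq x); last first.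
    move=> x0; have xE : nsq x = 0%R by apply/eqP; rewrite eq_le x0 nsq_ge0.
    rewrite /circ xE sqrtr0 (nsq_eq0 xE); apply: eq_integral => z _; congr f.
    by rewrite /rotate /scale2/= !mulr0 !mul0r subr0 addr0.
  have cs : ((dir x).1 ^+ 2 + (dir x).2 ^+ 2 = 1)%R by exact: nsq_dir.
  have ms : measurable_fun setT (fun z : mR * mR => f (scale2 (Num.sqrt (nsq x)) (dir z))).
    exact: (measurable_fun_pair2 (nsq x : mR) (measurable_circ_integrand mf)).
  rewrite /circ -(gauss_rotate cs)//.
  apply: eq_integral => z _; congr f; rewrite dir_rotate//.
  rewrite -{1}(scale2_dir x) /rotate /scale2/=.
  by congr pair; ring.
move=> ->; rewrite -[LHS]mul1e.
transitivity (\int[G]_y (\int[G]_x f x)).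
  transitivity (\int[G]_z f z * G setT); last exact/esym/integral_cst.
  by rewrite probability_setT muleC.
apply: eq_gauss_integral.
- exact: measurable_cst.
- exact: (@measurable_fun_fubini_tonelli_G _ _ _ _ _ G _ mH H0).
- by move=> z; exact: integral_ge0.
- by move=> z; exact: integral_ge0.
- by move=> z z0; rewrite /H/= gauss_rotate//; exact: nsq_dir.
Qed.

Lemma flip_gt0 (b t : R) : (0 < t)%R -> (0 < flip b t)%R.
Proof.
move=> t0; have [/flip_itv/andP[]//|h] := boolP ((0 <= t) && (t < b))%R.
by rewrite /flip (negbTE h).
Qed.

(** On one circle [hop c] multiplies by a constant: a dilation by [k] onto the new circle and a
    rotation, which the circle average absorbs. *)
Lemma circ_hop f (c t : R) : (0 < c ^+ 2 <= 1)%R -> (0 < t)%R ->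
  measurable_fun setT f -> (forall z, 0 <= f z) ->
  circ (f \o hop c) t = circ f (flip (c ^+ 2) t).
Proof.
move=> c01 t0 mf f0; set b := (c ^+ 2)%R in c01 *.
have fl0 := flip_gt0 b t0.
set k := Num.sqrt (flip b t / t).
have k0 : (0 < k)%R by rewrite sqrtr_gt0 divr_gt0.
pose c1 := ((1 + turn_re b t) / k)%R; pose s1 := (turn_im b t / k)%R.
have cs : (c1 ^+ 2 + s1 ^+ 2 = 1)%R.
  rewrite /c1 /s1 !expr_div_n -mulrDl turn_flip// sqr_sqrtr ?divff//.
    by rewrite gt_eqF// divr_gt0.
  by rewrite ltW// divr_gt0.
have md t' : measurable_fun setT (fun z : mR * mR => f (scale2 (Num.sqrt t') (dir z))).
  exact: (measurable_fun_pair2 (t' : mR) (measurable_circ_integrand mf)).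
have mdh : measurable_fun setT
    (fun z : mR * mR => (f \o hop c) (scale2 (Num.sqrt t) (dir z))).
  apply: (measurable_fun_pair2 (t : mR) (measurable_circ_integrand (f := f \o hop c) _)).
  exact: (measurableT_comp mf (measurable_hop c)).
rewrite /circ -(gauss_rotate cs (md _))//.
apply: eq_gauss_integral.
- exact: mdh.
- exact: (measurableT_comp (md (flip b t)) (measurable_rotate c1 s1)).
- by move=> z; exact: f0.
- by move=> z; exact: f0.
move=> z z0 /=; congr f; rewrite dir_rotate//.
have nE : nsq (scale2 (Num.sqrt t) (dir z)) = t.
  rewrite -[RHS]mulr1 -(nsq_dir z0) /nsq /scale2/= !exprMn sqr_sqrtr ?ltW//.
  by rewrite mulrDr.
rewrite /hop nE leNgt t0/= -/b.
have -> : Num.sqrt (flip b t) = (Num.sqrt t * k)%R.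
  by rewrite -sqrtrM ?ltW// mulrC divfK// gt_eqF.
have -> : (1 + turn_re b t = k * c1)%R by rewrite /c1 mulrC divfK// gt_eqF.
have -> : (turn_im b t = k * s1)%R by rewrite /s1 mulrC divfK// gt_eqF.
by rewrite /rotate /scale2/=; congr pair; ring.
Qed.

(** After the polar decomposition only the squared radius changes, by [flip], and [radial_flip] says
    that its law does not. *)
Lemma gauss_hop (c : R) (A : set (mR * mR)) : (0 < c ^+ 2 <= 1)%R -> measurable A ->
  G (hop c @^-1` A) = G A.
Proof.
move=> c01 mA; have [c0 _] := andP c01.
have mh := @measurable_hop R c.
pose f (z : mR * mR) : \bar R := (\1_A z)%:E.
have mf : measurable_fun setT f by apply/measurable_EFinP; exact: measurable_indic.
have f0 z : 0 <= f z by rewrite lee_fin.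
have mfh : measurable_fun setT (f \o hop c) := measurableT_comp mf mh.
have mc := measurable_circ mf f0.
have mfl := @measurable_flip R (c ^+ 2).
have mcf := measurableT_comp mc mfl.
have -> : G A = \int[G]_z f z.
  exact/esym/(@integral_indicT _ _ R G).
have -> : G (hop c @^-1` A) = \int[G]_z (f \o hop c) z.
  have -> : (fun z => (f \o hop c) z) = (fun z => (\1_(hop c @^-1` A) z)%:E :> \bar R).
    apply/funext => z; rewrite /f /= !indicE.
    suff -> : (z \in hop c @^-1` A) = (hop c z \in A) by [].
    by apply/idP/idP => /set_mem ?; exact/mem_set.
  apply/esym/(@integral_indicT _ _ R G).
  by rewrite -[X in measurable X]setTI; exact: mh.
transitivity (\int[G]_z circ (f \o hop c) (nsq z)).
  by apply: (polar mfh) => z; exact: f0.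
transitivity (\int[G]_z circ f (nsq z)); last exact/esym/(polar mf f0).
transitivity (\int[G]_z circ f (flip (c ^+ 2) (nsq z))).
  apply: eq_gauss_integral.
  - apply: (measurableT_comp (measurable_circ mfh _) (@measurable_nsq R)) => z.
    exact: f0.
  - exact: (measurableT_comp mcf (@measurable_nsq R)).
  - by move=> z; apply: circ_ge0 => w; exact: f0.
  - by move=> z; exact: circ_ge0.
  - by move=> z z0; exact: circ_hop.
transitivity (\int[radial R]_t circ f (flip (c ^+ 2) t)).
  apply/esym; apply: (ge0_integral_pushforward (@measurable_nsq R) _ measurableT mcf).
  by move=> t _; exact: circ_ge0.
transitivity (\int[radial R]_t circ f t); last first.
  apply: (ge0_integral_pushforward (@measurable_nsq R) _ measurableT mc).
  by move=> t _; exact: circ_ge0.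
transitivity (\int[push_measure (radial R) mfl]_t circ f t).
  apply/esym; apply: (ge0_integral_pushforward mfl _ measurableT mc).
  by move=> t _; exact: circ_ge0.
by apply: eq_measure_integral => B mB _; exact: radial_flip.
Qed.

End polar.

(** * Families of independent normal variables *)

Section plane_sets.
Variable R : realType.
Notation mR := (measurableTypeR R).
Notation N := (normal_prob (0 : R) 1).
Notation G := (gauss2 R).

Lemma gauss2X (A B : set mR) : measurable A -> measurable B ->
  G (A `*` B) = (N A * N B)%E.
Proof. exact: product_measure1E. Qed.

Lemma measure_unique_rect (m1 m2 : {measure set (mR * mR) -> \bar R}) :
  (forall A B : set mR, measurable A -> measurable B ->
    m1 (A `*` B) = m2 (A `*` B)) -> (m1 setT < +oo)%E ->
  forall X, measurable X -> m1 X = m2 X.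
Proof.
move=> m12 m1oo X mX.
pose C := [set C | exists2 A : set mR, measurable A &
  exists2 B : set mR, measurable B & C = A `*` B].
apply: (@measure_unique _ R (mR * mR)%type C (fun=> setT) _ _ _ _ m1 m2) => //.
- rewrite measurable_prod_measurableType; congr (<<s _ >>).
  apply/seteqP; split => [_ [A mA [B mB <-]]|_ [A mA [B mB ->]]].
    by exists A => //; exists B.
  by exists A => //; exists B.
- move=> _ _ [A1 mA1 [B1 mB1 ->]] [A2 mA2 [B2 mB2 ->]].
  exists (A1 `&` A2); first exact: measurableI.
  by exists (B1 `&` B2); [exact: measurableI|rewrite setXI].
- by move=> _; exists setT => //; exists setT => //; rewrite setXTT.
- by rewrite -subTset => x _; exists 0%N.
- by move=> _ [A mA [B mB ->]]; exact: m12.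
Qed.

Lemma gauss2_rotate (c s : R) (A : set (mR * mR)) : c ^+ 2 + s ^+ 2 = 1 ->
  measurable A -> G (rotate c s @^-1` A) = G A.
Proof.
move=> cs mA; have mr := @measurable_rotate R c s.
pose f (z : mR * mR) : \bar R := (\1_A z)%:E.
have mf : measurable_fun setT f by apply/measurable_EFinP; exact: measurable_indic.
have f0 z : (0 <= f z)%E by rewrite lee_fin.
have e1 : (\int[G]_z f z)%E = G A by exact: (@integral_indicT _ _ R G).
rewrite -e1 -(gauss_rotate cs mf f0).
have -> : (fun z => f (rotate c s z)) = (fun z => (\1_(rotate c s @^-1` A) z)%:E :> \bar R).
  apply/funext => z; rewrite /f /= !indicE.
  suff -> : (z \in rotate c s @^-1` A) = (rotate c s z \in A) by [].
  by apply/idP/idP => /set_mem ?; exact/mem_set.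
apply/esym/(@integral_indicT _ _ R G).
by rewrite -[X in measurable X]setTI; exact: mr.
Qed.

End plane_sets.

Section iid.
Context (R : realType) d (T : measurableType d) (P : probability T R).
Notation mR := (measurableTypeR R).
Notation N := (normal_prob (0 : R) 1).

(** Taking some of the [A i] to be [setT] recovers the marginals and the product formula for every
    subfamily. *)
Definition iid_normal (I : finType) (W : I -> T -> R) : Prop :=
  (forall i, measurable_fun setT (W i)) /\
  forall A : I -> set R, (forall i, measurable (A i)) ->
    P [set w | forall i, A i (W i w)] = (\prod_i N (A i))%E.

Definition pair_update (I : eqType) (i k : I) (psi : R * R -> R * R)
    (W : I -> T -> R) : I -> T -> R :=
  fun j w => if j == i then (psi (W i w, W k w)).1
             else if j == k then (psi (W i w, W k w)).2 else W j w.

(** Freeze an event [E] on the other coordinates. Restricted to [E], the law of the pair is a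
    multiple of the planar Gaussian, because rectangles determine finite measures; it can then be
    evaluated on the preimage under [psi] of a rectangle, which need not be one. *)
Lemma iid_pair_update (I : finType) (W : I -> T -> R) (i k : I)
    (psi : mR * mR -> mR * mR) :
  measurable_fun setT psi ->
  (forall A, measurable A -> gauss2 R (psi @^-1` A) = gauss2 R A) ->
  i != k -> iid_normal W -> iid_normal (pair_update i k psi W).
Proof.
move=> mpsi psiG ik [mW WE].
have mp : measurable_fun setT (fun w => (W i w, W k w) : mR * mR).
  by apply: measurable_fun_pair; exact: mW.
have mpp := measurableT_comp mpsi mp.
split=> [j|A mA].
  rewrite /pair_update; case: (j == i); last case: (j == k).
  - exact: (measurableT_comp measurable_fst mpp).
  - exact: (measurableT_comp measurable_snd mpp).
  - exact: mW.
pose E := [set w | forall j, j != i -> j != k -> A j (W j w)].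
have mE : measurable E.
  have -> : E = \bigcap_(j in [set: I])
      (if (j != i) && (j != k) then W j @^-1` A j else setT).
    apply/seteqP; split => w /= h j.
      by move=> _; case: ifPn => // /andP[ji jk]; exact: h.
    by move=> ji jk; have := h j Logic.I; rewrite ji jk.
  apply: fin_bigcap_measurable; first exact: finite_finset.
  move=> j _; case: ifP => // _.
  by rewrite -[X in measurable X]setTI; exact: mW.
pose p := (\prod_(j | (j != i) && (j != k)) N (A j))%E.
have p0 : (0 <= p)%E by apply: prode_ge0 => j _; exact: measure_ge0.
have pfin : p \is a fin_num.
  by apply: prode_fin_num => j _; apply: fin_num_measure; exact: mA.
have p0' : 0 <= fine p by exact: fine_ge0.
have rect (B1 B2 : set R) : measurable B1 -> measurable B2 ->
    P ((fun w => (W i w, W k w)) @^-1` (B1 `*` B2) `&` E) = (p * (N B1 * N B2))%E.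
  move=> mB1 mB2.
  pose A' j := if j == i then B1 else if j == k then B2 else A j.
  have mA' j : measurable (A' j).
    by rewrite /A'; case: (j == i); [|case: (j == k)].
  have -> : (fun w => (W i w, W k w)) @^-1` (B1 `*` B2) `&` E =
      [set w | forall j, A' j (W j w)].
    apply/seteqP; split => w /=.
      move=> [[b1 b2] h] j; rewrite /A'; case: eqVneq => [->//|ji].
      by case: eqVneq => [->//|jk]; exact: h.
    move=> h; split.
      have := h i; have := h k; rewrite /A' !eqxx eq_sym (negbTE ik); by split.
    by move=> j ji jk; have := h j; rewrite /A' (negbTE ji) (negbTE jk).
  rewrite WE// (bigD1 i)//= (bigD1 k)//=; last by rewrite eq_sym.
  rewrite /A' eqxx eq_sym (negbTE ik) eqxx muleA muleC; congr (_ * _)%E.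
  by apply: eq_bigr => j /andP[/negbTE -> /negbTE ->].
pose m1 : {measure set (mR * mR) -> \bar R} := push_measure (mrestr P mE) mp.
pose m2 : {measure set (mR * mR) -> \bar R} := mscale (NngNum p0') (gauss2 R).
have m12 X : measurable X -> m1 X = m2 X.
  move=> mX; apply: (measure_unique_rect (m1 := m1) (m2 := m2)) mX => [B1 B2 mB1 mB2|].
    transitivity (p * (N B1 * N B2))%E; first exact: rect.
    by rewrite /m2/= /mscale/= fineK// -gauss2X.
  apply: (@le_lt_trans _ _ 1%E); last exact: ltry.
  by apply: probability_le1; rewrite preimage_setT setTI.
have mAA : measurable (A i `*` A k : set (mR * mR)).
  by apply: measurableX; exact: mA.
have mpsiA : measurable (psi @^-1` (A i `*` A k) : set (mR * mR)).
  by rewrite -[X in measurable X]setTI; exact: mpsi.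
transitivity (m1 (psi @^-1` (A i `*` A k))).
  congr (P _); apply/seteqP; split => w /=.
    move=> h; split; last first.
      by move=> j ji jk; have := h j; rewrite /pair_update (negbTE ji) (negbTE jk).
    have := h i; have := h k.
    by rewrite /pair_update !eqxx eq_sym (negbTE ik); split.
  move=> [[a1 a2] h] j; rewrite /pair_update.
  case: eqVneq => [->//|ji]; case: eqVneq => [->//|jk]; exact: h.
transitivity (p * (N (A i) * N (A k)))%E.
  rewrite m12// /m2/= /mscale/= fineK//; congr (_ * _)%E.
  transitivity (gauss2 R (A i `*` A k)); first exact: psiG.
  by apply: gauss2X; exact: mA.
rewrite [RHS](bigD1 i)//= (bigD1 k)/=; last by rewrite eq_sym.
by rewrite muleA [RHS]muleC.
Qed.

Lemma iid_normal_marginal (I : finType) (W : I -> T -> R) (i : I) (B : set R) :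
  iid_normal W -> measurable B -> P (W i @^-1` B) = N B.
Proof.
move=> [mW WE] mB.
pose A j := if j == i then B else setT.
have mA j : measurable (A j) by rewrite /A; case: ifP.
transitivity (P [set w | forall j, A j (W j w)]).
  congr (P _); apply/seteqP; split => w /=.
    by move=> h j; rewrite /A; case: eqP => [->|].
  by move=> /(_ i); rewrite /A eqxx.
rewrite WE// (bigD1 i)//= /A eqxx big1 ?mule1// => j /negbTE ->.
exact: probability_setT.
Qed.

End iid.

(** * The steering rule and rotations of pairs of columns *)

Section rows.
Variable R : realType.
Variable m : nat.
Implicit Types (x y v : 'rV[R]_m) (i k : 'I_m).

Lemma dotpBl x y v : dotp (x - y) v = dotp x v - dotp y v.
Proof. by rewrite /dotp -sumrB; apply: eq_bigr => j _; rewrite !mxE mulrBl. Qed.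

Lemma dotpZl (a : R) x v : dotp (a *: x) v = a * dotp x v.
Proof. by rewrite /dotp mulr_sumr; apply: eq_bigr => j _; rewrite mxE mulrA. Qed.

Definition plane_rot i k (c s : R) x : 'rV[R]_m :=
  \row_j if j == i then c * x ord0 i - s * x ord0 k
         else if j == k then s * x ord0 i + c * x ord0 k else x ord0 j.

Lemma plane_rotD i k c s x y :
  plane_rot i k c s (x + y) = plane_rot i k c s x + plane_rot i k c s y.
Proof.
apply/rowP => j; rewrite !mxE.
by case: (j == i); [|case: (j == k)] => //; ring.
Qed.

Lemma plane_rotZ i k c s (a : R) x :
  plane_rot i k c s (a *: x) = a *: plane_rot i k c s x.
Proof.
apply/rowP => j; rewrite !mxE.
by case: (j == i); [|case: (j == k)] => //; ring.
Qed.

Lemma plane_rot_dotp i k c s x y : i != k -> c ^+ 2 + s ^+ 2 = 1 ->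
  dotp (plane_rot i k c s x) (plane_rot i k c s y) = dotp x y.
Proof.
move=> ik cs; have ki : k != i by rewrite eq_sym.
rewrite /dotp (bigD1 i)//= (bigD1 k)//= [in RHS](bigD1 i)//=.
rewrite [X in _ = _ + X](bigD1 k)//= !addrA; congr (_ + _); last first.
  by apply: eq_bigr => j /andP[/negbTE ji /negbTE jk]; rewrite !mxE ji jk.
rewrite !mxE eqxx (negbTE ki) eqxx.
transitivity ((c ^+ 2 + s ^+ 2) * (x ord0 i * y ord0 i + x ord0 k * y ord0 k));
  last by rewrite cs mul1r.
by ring.
Qed.

Lemma plane_rotK i k c s x : i != k -> c ^+ 2 + s ^+ 2 = 1 ->
  plane_rot i k c (- s) (plane_rot i k c s x) = x.
Proof.
move=> ik cs; have ki : k != i by rewrite eq_sym.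
apply/rowP => j; rewrite !mxE eqxx (negbTE ki) eqxx.
case: eqVneq => [->|ji].
  transitivity ((c ^+ 2 + s ^+ 2) * x ord0 i); last by rewrite cs mul1r.
  by ring.
case: eqVneq => [->|jk//].
transitivity ((c ^+ 2 + s ^+ 2) * x ord0 k); last by rewrite cs mul1r.
by ring.
Qed.

(* For p + i q = |v| X, the increment |v| (u_1 + i u_2) is
   (turn_re + i turn_im) X. *)
Definition steer v x y : R * R :=
  let a := dotp v v in
  let p := dotp v x in
  let q := dotp v y in
  let t := (p ^+ 2 + q ^+ 2) / a in
  if a <= 0 then (1, 0) else if t <= 0 then (1, 0) else
  ((turn_re a t * p - turn_im a t * q) / a,
   (turn_re a t * q + turn_im a t * p) / a).

Definition advance1 v x y : 'rV[R]_m := x + (steer v x y).1 *: v.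
Definition advance2 v x y : 'rV[R]_m := y + (steer v x y).2 *: v.

Lemma steer_unit v x y : dotp v v <= 1 ->
  (steer v x y).1 ^+ 2 + (steer v x y).2 ^+ 2 = 1.
Proof.
move=> v1; rewrite /steer; case: leP => [_|a0]/=.
  by rewrite expr1n expr0n addr0.
case: leP => [_|t0]/=; first by rewrite expr1n expr0n addr0.
set a := dotp v v in v1 a0 t0 *; set p := dotp v x in t0 *; set q := dotp v y in t0 *.
set t := (p ^+ 2 + q ^+ 2) / a in t0 *.
have a01 : 0 < a <= 1 by rewrite a0.
have e := turn_normed a01 t0.
transitivity ((turn_re a t ^+ 2 + turn_im a t ^+ 2) * ((p ^+ 2 + q ^+ 2) / a) / a).
  by field; exact: lt0r_neq0.
by rewrite e -/t divfK ?divff// gt_eqF.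
Qed.

(** [steer] reads its arguments through dot products only. This is what allows [v] to be turned onto
    an axis. *)
Lemma steer_rot i k c s v x y : i != k -> c ^+ 2 + s ^+ 2 = 1 ->
  let L := plane_rot i k c s in steer (L v) (L x) (L y) = steer v x y.
Proof. by move=> ik cs L; rewrite /steer /L !plane_rot_dotp. Qed.

End rows.

Section iid_rows.
Context (R : realType) d (T : measurableType d) (P : probability T R) (m : nat).
Notation mR := (measurableTypeR R).
Implicit Types (X Y : T -> 'rV[R]_m) (v : 'rV[R]_m).

Definition iid_rows X Y := iid_normal P
  (fun (bj : bool * 'I_m) w => (if bj.1 then X w else Y w) ord0 bj.2).

Lemma eq_iid_normal (I : finType) (W W' : I -> T -> R) : (forall i, W i =1 W' i) ->
  iid_normal P W -> iid_normal P W'.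
Proof.
move=> e; suff -> : W = W' by [].
by apply/funext => i; apply/funext => w; exact: e.
Qed.

Lemma iid_rows_rot i k c s X Y : i != k -> c ^+ 2 + s ^+ 2 = 1 ->
  iid_rows X Y ->
  iid_rows (fun w => plane_rot i k c s (X w)) (fun w => plane_rot i k c s (Y w)).
Proof.
move=> ik cs h.
have mr := @measurable_rotate R c s.
have gr A : measurable A -> gauss2 R (rotate c s @^-1` A) = gauss2 R A.
  exact: gauss2_rotate.
have ik1 (b : bool) : (b, i) != (b, k) by rewrite xpair_eqE eqxx.
have := iid_pair_update mr gr (ik1 false) (iid_pair_update mr gr (ik1 true) h).
apply: eq_iid_normal => -[b j] w; rewrite /pair_update /= !xpair_eqE.
by case: b; rewrite /= !mxE.
Qed.

(** Only column [i] moves, and it moves by [hop c]: the factors of [c] cancel between [steer] and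
    [v], whatever its sign. *)
Lemma iid_rows_advance_axis i (c : R) X Y : c ^+ 2 <= 1 ->
  let v := \row_j (if j == i then c else 0) in
  iid_rows X Y ->
  iid_rows (fun w => advance1 v (X w) (Y w)) (fun w => advance2 v (X w) (Y w)).
Proof.
move=> c1 v h.
have dE x : dotp v x = c * x ord0 i.
  rewrite /dotp (bigD1 i)//= big1 ?addr0 => [|j /negbTE ji]; rewrite mxE ?eqxx//.
  by rewrite ji mul0r.
have [c0|c0] := eqVneq c 0.
  have v0 : v = 0 by apply/rowP => j; rewrite !mxE c0; case: ifP.
  by apply: eq_iid_normal h => -[b j] w; rewrite /advance1 /advance2 v0 !scaler0 !addr0.
have c2 : 0 < c ^+ 2 by rewrite exprn_even_gt0.
have c01 : 0 < c ^+ 2 <= 1 by rewrite c2.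
have ne : (true, i) != (false, i) by [].
have := iid_pair_update (@measurable_hop R c) (fun A => gauss_hop c01) ne h.
apply: eq_iid_normal => -[b j] w; rewrite /pair_update /= !xpair_eqE.
set x := X w; set y := Y w.
have tE : ((c * x ord0 i) ^+ 2 + (c * y ord0 i) ^+ 2) / c ^+ 2 = nsq (x ord0 i, y ord0 i).
  by rewrite /nsq/=; field.
have key : hop c (x ord0 i, y ord0 i) =
    (x ord0 i + (steer v x y).1 * c, y ord0 i + (steer v x y).2 * c).
  rewrite /steer !dE (_ : c * v ord0 i = c ^+ 2); last by rewrite mxE eqxx expr2.
  rewrite tE leNgt c2/= /hop.
  case: leP => [_|n0]/=; first by rewrite mul1r mul0r addr0.
  by rewrite /rotate/=; congr pair; field.
case: b => /=; rewrite /advance1 /advance2 !mxE; case: eqVneq => [->|ji]; rewrite ?key//=.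
  by rewrite mulr0 addr0.
by rewrite mulr0 addr0.
Qed.

Lemma iid_rows_advance v X Y : dotp v v <= 1 -> iid_rows X Y ->
  iid_rows (fun w => advance1 v (X w) (Y w)) (fun w => advance2 v (X w) (Y w)).
Proof.
(* Rotating two columns of W into each other kills an entry of v. *)
have [n] := ubnP #|[pred j | v ord0 j != 0%R]|.
elim: n v X Y => // n IH v X Y vn v1 h.
have [/existsP[i /existsP[k /and3P[ik vi vk]]]|] :=
  boolP [exists i, exists k, [&& i != k, v ord0 i != 0 & v ord0 k != 0]].
  set hh := v ord0 i ^+ 2 + v ord0 k ^+ 2.
  have h0 : 0 < hh by rewrite ltr_wpDr ?sqr_ge0// exprn_even_gt0.
  pose l := Num.sqrt hh.
  have l0 : 0 < l by rewrite sqrtr_gt0.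
  have l2 : l ^+ 2 = hh by rewrite sqr_sqrtr// ltW.
  (* The rotation that takes the entries [i] and [k] of [v] to [l] and 0; it is nonrandom because
     [v] is. *)
  pose c := v ord0 i / l; pose s := - (v ord0 k / l).
  have cs : c ^+ 2 + s ^+ 2 = 1.
    by rewrite /c /s sqrrN !expr_div_n -mulrDl l2 divff// gt_eqF.
  have cs' : c ^+ 2 + (- s) ^+ 2 = 1 by rewrite sqrrN.
  pose L := plane_rot i k c s.
  have Lk : L v ord0 k = 0.
    rewrite mxE eq_sym (negbTE ik) eqxx /s /c; ring.
  have Lv1 : dotp (L v) (L v) <= 1 by rewrite plane_rot_dotp.
  have Ln : (#|[pred j | L v ord0 j != 0%R]| < n)%N.
    apply: leq_trans (vn : (_ <= n)%N); apply: proper_card.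
    apply/properP; split.
      apply/fintype.subsetP => j; rewrite !inE; apply: contraNN => /eqP vj.
      rewrite mxE; have [ji|_] := eqVneq j i; first by case/eqP: vi; rewrite -ji.
      by have [jk|_] := eqVneq j k; [case/eqP: vk; rewrite -jk|rewrite vj eqxx].
    by exists k; rewrite !inE ?vk// Lk eqxx.
  (* Rotate, advance along [L v], rotate back: by [steer_rot] and linearity this is the advance
     along [v]. *)
  have := IH _ _ _ Ln Lv1 (iid_rows_rot ik cs h).
  move/(iid_rows_rot ik cs'); apply: eq_iid_normal => -[b j] w /=.
  by case: b; rewrite /advance1 /advance2 steer_rot// -plane_rotZ -plane_rotD plane_rotK.
rewrite negb_exists => /forallP nv.
have [/existsP[i vi]|] := boolP [exists i, v ord0 i != 0]; last first.
  rewrite negb_exists => /forallP v0.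
  have -> : v = 0 by apply/rowP => j; rewrite mxE; apply/eqP; rewrite -[_ == _]negbK v0.
  by apply: eq_iid_normal h => -[b j] w; rewrite /advance1 /advance2 !scaler0 !addr0.
have vE : v = \row_j (if j == i then v ord0 i else 0).
  apply/rowP => j; rewrite mxE; case: eqVneq => [->//|ji].
  have := nv i; rewrite negb_exists => /forallP/(_ j).
  by rewrite eq_sym ji vi/= negbK => /eqP.
rewrite vE; apply: iid_rows_advance_axis => //.
apply: le_trans v1; rewrite /dotp (bigD1 i)//= expr2 lerDl.
by apply: sumr_ge0 => j _; rewrite -expr2 sqr_ge0.
Qed.

End iid_rows.

(** * The program *)

Notation "'#' n" := (IConst n) (at level 1, format "'#' n").

(* Register 3 is set once the rows have been drawn, register 4 is the loop counter.
   Arrays 3 and 4 hold the two rows of W, array 5 the scalars |v|^2, the two dot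
   products of v with the rows, t, flip |v|^2 t, turn_re and turn_im. *)
Definition prog_init : cmd :=
  If (ILe #1 (IVar 3)) Skip
    (Seq (ISet 3 #1)
      (For 4 (IVar 1) (Seq (DrawN 3 (IVar 4)) (DrawN 4 (IVar 4))))).

Definition prog_dots : cmd :=
  Seq (RSet 5 #0 (RNat #0)) (Seq (RSet 5 #1 (RNat #0)) (Seq (RSet 5 #2 (RNat #0))
    (For 4 (IVar 1)
      (Seq (RSet 5 #0 (RAdd (RGet 5 #0) (RMul (RGet 0 (IVar 4)) (RGet 0 (IVar 4)))))
      (Seq (RSet 5 #1 (RAdd (RGet 5 #1) (RMul (RGet 0 (IVar 4)) (RGet 3 (IVar 4)))))
           (RSet 5 #2 (RAdd (RGet 5 #2) (RMul (RGet 0 (IVar 4)) (RGet 4 (IVar 4)))))))))).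

Definition prog_default : cmd := Seq (RSet 1 #0 (RNat #1)) (RSet 1 #1 (RNat #0)).

Definition exp_half (e : rexpr) : rexpr := RExp (RDiv (RSub (RNat #0) e) (RNat #2)).

Definition prog_steer : cmd :=
  let a := RGet 5 #0 in let p := RGet 5 #1 in let q := RGet 5 #2 in
  let t := RGet 5 #3 in let t' := RGet 5 #4 in
  let re := RGet 5 #5 in let im := RGet 5 #6 in
  If (RLe a (RNat #0)) prog_default
  (Seq (RSet 5 #3 (RDiv (RAdd (RMul p p) (RMul q q)) a))
  (If (RLe t (RNat #0)) prog_default
  (Seq (If (RLe a t) (RSet 5 #4 t)
         (RSet 5 #4 (RMul (RSub (RNat #0) (RNat #2))
           (RLn (RSub (RAdd (RNat #1) (exp_half a)) (exp_half t))))))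
  (Seq (RSet 5 #5 (RDiv (RSub (RSub t' t) a) (RMul (RNat #2) t)))
  (Seq (RSet 5 #6 (RSqrt (RSub (RDiv a t) (RMul re re))))
  (Seq (RSet 1 #0 (RDiv (RSub (RMul re p) (RMul im q)) a))
       (RSet 1 #1 (RDiv (RAdd (RMul re q) (RMul im p)) a)))))))).

Definition prog_move : cmd :=
  For 4 (IVar 1)
    (Seq (RSet 3 (IVar 4) (RAdd (RGet 3 (IVar 4)) (RMul (RGet 1 #0) (RGet 0 (IVar 4)))))
         (RSet 4 (IVar 4) (RAdd (RGet 4 (IVar 4)) (RMul (RGet 1 #1) (RGet 0 (IVar 4)))))).

Definition walk : cmd := Seq prog_init (Seq prog_dots (Seq prog_steer prog_move)).

(** * Execution and cost of the pieces of the program *)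

Section machine.
Variable R : realType.
Implicit Types (s : state R) (w : tape R).

Lemma run_Seq w c1 c2 s : run w (Seq c1 c2) s =
  ((run w c2 (run w c1 s).1).1,
   (run w c1 s).2 + (run w c2 (run w c1 s).1).2)%N.
Proof. by rewrite /=; case: (run w c1 s) => s1 n1 /=; case: (run w c2 s1). Qed.

Lemma run_If w b c1 c2 s : run w (If b c1 c2) s =
  ((run w (if beval s b then c1 else c2) s).1,
   bcost b + (run w (if beval s b then c1 else c2) s).2)%N.
Proof. by rewrite /=; case: (run w _ s). Qed.

(** A loop rule that tracks the invariant and the time together. [K] bounds one pass of the body,
    and the successor pays for the step of the loop itself. *)
Lemma run_For w x e c s (K : nat) (Inv : nat -> state R -> Prop) :
  Inv 0%N s ->
  (forall k s', (k < ieval s e)%N -> Inv k s' ->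
     Inv k.+1 (run w c (set_ireg s' x k)).1 /\
     ((run w c (set_ireg s' x k)).2 <= K)%N) ->
  Inv (ieval s e) (run w (For x e c) s).1 /\
  ((run w (For x e c) s).2 <= (icost e).+1 + ieval s e * K.+1)%N.
Proof.
move=> I0 IS /=; set f := (fun k sn => _).
have fE k sn : f k sn = ((run w c (set_ireg sn.1 x k)).1,
    (sn.2 + (run w c (set_ireg sn.1 x k)).2).+1) by rewrite /f; case: (run _ _ _).
suff H n : (n <= ieval s e)%N ->
    Inv n (iteri n f (s, (icost e).+1)).1 /\
    ((iteri n f (s, (icost e).+1)).2 <= (icost e).+1 + n * K.+1)%N by exact: H.
elim: n => [_|n IH ne]; first by split => //; rewrite addn0.
have [In cn] := IH (ltnW ne); have [] := IS n _ ne In.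
rewrite [f]lock /= -lock fE /= => I2 c2; split => //.
set p := (_ * K.+1)%N in cn; rewrite mulSn -/p.
by move: cn c2; lia.
Qed.

(** [ms] and [rs] are the arrays and the registers that may change. *)
Definition frame (ms rs : pred nat) s s' :=
  (forall b, ~~ ms b -> rmem s' b = rmem s b) /\
  (forall x, ~~ rs x -> ireg s' x = ireg s x).

Lemma run_init w s (m : nat) : ireg s 1 = m -> ireg s 3 = 0%N -> draws s = 0%N ->
  let s' := (run w prog_init s).1 in let n := (run w prog_init s).2 in
  [/\ forall j, (j < m)%N -> rmem s' 3 j = tape_N w j.*2,
      forall j, (j < m)%N -> rmem s' 4 j = tape_N w j.*2.+1,
      frame (pred2 3 4)%N (pred2 3 4)%N s s',
      ireg s' 3 = 1%N & (n <= 10 + 5 * m)%N].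
Proof.
move=> sm s3 d0; rewrite /prog_init run_If /= s3 /=.
set s1 := set_ireg s 3 1.
pose Inv k s' := [/\ forall j, (j < k)%N -> rmem s' 3 j = tape_N w j.*2,
  forall j, (j < k)%N -> rmem s' 4 j = tape_N w j.*2.+1,
  frame (pred2 3 4)%N (pred2 3 4)%N s s', ireg s' 3 = 1%N & draws s' = k.*2].
have [||[I1 I2 I3 I4 _] C] := @run_For w 4 (IVar 1)
    (Seq (DrawN 3 (IVar 4)) (DrawN 4 (IVar 4))) s1 4 Inv.
- split => //=.
  by split => // x; rewrite negb_or => /andP[/negbTE x3 _] /=; rewrite x3.
- move=> k s' _ [J1 J2 [F1 F2] J3 J4]; split => //; split => /=.
  + move=> j; rewrite ltnS leq_eqVlt => /orP[/eqP->|jk]; first by rewrite eqxx J4.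
    by rewrite (ltn_eqF jk) J1.
  + move=> j; rewrite ltnS leq_eqVlt => /orP[/eqP->|jk]; first by rewrite eqxx J4.
    by rewrite (ltn_eqF jk) J2.
  + split => [b|x] /=; rewrite negb_or => /andP[/negbTE h1 /negbTE h2].
      by rewrite h1 h2 /=; have := F1 b; rewrite /= h1 h2 => ->.
    by rewrite h2; apply: F2; rewrite /= h1 h2.
  + exact: J3.
  + by rewrite J4 doubleS.
move: I1 I2 I3 I4 C; rewrite /= sm.
case: (iteri _ _ _) => s' n /= I1 I2 I3 I4 C; split => //; lia.
Qed.

Lemma run_dots w s (m : nat) : ireg s 1 = m ->
  let s' := (run w prog_dots s).1 in let n := (run w prog_dots s).2 in
  [/\ rmem s' 5 0 = \sum_(j < m) rmem s 0 j * rmem s 0 j,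
      rmem s' 5 1 = \sum_(j < m) rmem s 0 j * rmem s 3 j,
      rmem s' 5 2 = \sum_(j < m) rmem s 0 j * rmem s 4 j,
      frame (pred1 5) (pred1 4) s s' & (n <= 20 + 40 * m)%N].
Proof.
move=> sm; rewrite /prog_dots !run_Seq.
set s1 := (run w (RSet 5 #2 _) _).1.
pose Inv k s' := [/\ rmem s' 5 0 = \sum_(j < k) rmem s 0 j * rmem s 0 j,
  rmem s' 5 1 = \sum_(j < k) rmem s 0 j * rmem s 3 j,
  rmem s' 5 2 = \sum_(j < k) rmem s 0 j * rmem s 4 j &
  frame (pred1 5) (pred1 4) s s'].
set c := Seq (RSet 5 #0 _) _.
have [||[I1 I2 I3 I4] C] := @run_For w 4 (IVar 1) c s1 39 Inv.
- split; rewrite ?big_ord0//; split => // b /= /negbTE b5.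
  by apply/funext => j; rewrite /s1 /= b5.
- move=> k s' _ [J1 J2 J3 [F1 F2]]; rewrite /c; split => //; split => /=.
  + by rewrite J1 !F1// big_ord_recr.
  + by rewrite J2 !F1// big_ord_recr.
  + by rewrite J3 !F1// big_ord_recr.
  + split => [b|x] /= /negbTE h; last by rewrite h F2//= h.
    by apply/funext => j; rewrite h /= F1//= h.
move: I1 I2 I3 I4 C; rewrite /= sm.
case: (iteri _ _ _) => s' n /= I1 I2 I3 I4 C; split => //; lia.
Qed.

Lemma run_steer w s (m : nat) (v x y : 'rV[R]_m) :
  rmem s 5 0 = dotp v v -> rmem s 5 1 = dotp v x -> rmem s 5 2 = dotp v y ->
  let s' := (run w prog_steer s).1 in let n := (run w prog_steer s).2 in
  [/\ rmem s' 1 0 = (steer v x y).1, rmem s' 1 1 = (steer v x y).2,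
      forall j, (2 <= j)%N -> rmem s' 1 j = rmem s 1 j,
      frame (pred2 1 5)%N pred0 s s' & (n <= 200)%N].
Proof.
move=> ea ep eq; rewrite /prog_steer run_If /steer -ea -ep -eq.
set a := rmem s 5 0; set p := rmem s 5 1; set q := rmem s 5 2.
(* Both degenerate cases, v = 0 and W v = 0, end in [prog_default], but from different states; it is
   specified once for all of them. *)
have def s0 : frame (pred2 1 5)%N pred0 s s0 ->
    (forall j, (2 <= j)%N -> rmem s0 1 j = rmem s 1 j) ->
    let s' := (run w prog_default s0).1 in let n := (run w prog_default s0).2 in
    [/\ rmem s' 1 0 = (1 : R), rmem s' 1 1 = (0 : R),
      forall j, (2 <= j)%N -> rmem s' 1 j = rmem s 1 j,
      frame (pred2 1 5)%N pred0 s s' & (n <= 8)%N].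
  move=> [F1 F2] h s' n; split => //=; first by case=> [|[|j]] //= _; rewrite h.
  split => [b|x0] /=; last by move=> _; rewrite F2.
  move=> /[dup] bb; rewrite negb_or => /andP[/negbTE b1 _].
  by apply/funext => j; rewrite b1 /= F1.
have sE : frame (pred2 1 5)%N pred0 s s by [].
rewrite [beval _ _](_ : _ = (a <= 0))//; have [_|a0] := leP a 0.
  have [h1 h2 h3 h4 h5] := def s sE (fun _ _ => erefl).
  by split => //; apply: leq_trans (leq_add (leqnn _) h5) _.
rewrite run_Seq run_If.
set s1 := (run w (RSet 5 #3 _) s).1.
have t1 : rmem s1 5 3 = (p ^+ 2 + q ^+ 2) / a by rewrite /s1 /= !expr2.
have s1E : frame (pred2 1 5)%N pred0 s s1.
  split => // b; rewrite negb_or => /andP[_ /negbTE b5].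
  by apply/funext => j; rewrite /s1/= b5.
set t := (p ^+ 2 + q ^+ 2) / a in t1 *.
have s10 : [/\ rmem s1 5 0 = a, rmem s1 5 1 = p & rmem s1 5 2 = q] by [].
have s11 j : rmem s1 1 j = rmem s 1 j by [].
clearbody s1; case: s10 => s1a s1p s1q.
rewrite [beval s1 _](_ : _ = (t <= 0)); last by rewrite /= t1.
have [_|t0] := leP t 0.
  have [h1 h2 h3 h4 h5] := def s1 s1E (fun j _ => s11 j).
  by split.
rewrite !run_Seq run_If [beval s1 _](_ : _ = (a <= t)); last by rewrite /= t1 s1a.
set cc := if _ then _ else _.
set s2 := (run w cc s1).1.
have ncc : ((run w cc s1).2 <= 40)%N by rewrite /cc; case: ifP.
have s20 : [/\ rmem s2 5 0 = a, rmem s2 5 1 = p, rmem s2 5 2 = q, rmem s2 5 3 = t &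
    rmem s2 5 4 = flip a t].
  rewrite /s2 /cc; case: ifPn => at_ /=; split => //.
    by rewrite t1 /flip [(t < a)%R]ltNge at_ andbF.
  by rewrite t1 s1a /flip ltW//= ltNge at_/= !sub0r.
have s2E : frame (pred2 1 5)%N pred0 s s2.
  case: s1E => F1 F2; rewrite /s2 /cc; split => [b|x0 x00]; last first.
    by case: ifP => _ /=; rewrite F2.
  move=> /[dup] bb; rewrite negb_or => /andP[_ /negbTE b5].
  by apply/funext => j; case: ifP => _ /=; rewrite b5 /= F1.
have s21 j : rmem s2 1 j = rmem s 1 j.
  by rewrite /s2 /cc -s11; case: ifP.
case: s20 => e0 e1 e2 e3 e4; clearbody s2.
have reE : (flip a t - t - a) / (2 * t) = turn_re a t by [].
have imE : Num.sqrt (a / t - turn_re a t * turn_re a t) = turn_im a t.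
  by rewrite /turn_im expr2.
split => /=.
- by rewrite e0 e1 e2 e3 e4 reE imE.
- by rewrite e0 e1 e2 e3 e4 reE imE.
- by case=> [|[|j]] //= _; rewrite s21.
- case: s2E => F1 F2; split => [b|x0 x00] /=; last by rewrite F2.
  move=> /[dup] bb; rewrite negb_or => /andP[/negbTE b1 /negbTE b5].
  by apply/funext => j; rewrite b1 b5 /= F1.
- by lia.
Qed.

Lemma run_move w s (m : nat) : ireg s 1 = m ->
  let s' := (run w prog_move s).1 in let n := (run w prog_move s).2 in
  [/\ forall j, (j < m)%N -> rmem s' 3 j = rmem s 3 j + rmem s 1 0 * rmem s 0 j,
      forall j, (j < m)%N -> rmem s' 4 j = rmem s 4 j + rmem s 1 1 * rmem s 0 j,
      frame (pred2 3 4)%N (pred1 4) s s' & (n <= 10 + 30 * m)%N].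
Proof.
move=> sm; rewrite /prog_move.
pose Inv k s' := [/\
  forall j, rmem s' 3 j = rmem s 3 j + (if (j < k)%N then rmem s 1 0 * rmem s 0 j else 0),
  forall j, rmem s' 4 j = rmem s 4 j + (if (j < k)%N then rmem s 1 1 * rmem s 0 j else 0)
  & frame (pred2 3 4)%N (pred1 4) s s'].
set c := Seq _ _.
have [||[I1 I2 I3] C] := @run_For w 4 (IVar 1) c s 29 Inv.
- by split => // j; rewrite addr0.
- move=> k s' _ [J1 J2 [F1 F2]]; rewrite /c; split => //; split => /=.
  + move=> j; rewrite (F1 0%N isT) (F1 1%N isT) !J1; case: eqVneq => [->|jk].
      by rewrite ltnn ltnSn addr0.
    by rewrite ltnS [(j <= k)%N]leq_eqVlt (negbTE jk).
  + move=> j; rewrite (F1 0%N isT) (F1 1%N isT) !J2; case: eqVneq => [->|jk].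
      by rewrite ltnn ltnSn addr0.
    by rewrite ltnS [(j <= k)%N]leq_eqVlt (negbTE jk).
  + split => [b|x] /=; last by move=> /negbTE h; rewrite h F2//= h.
    move=> /[dup] bb; rewrite negb_or => /andP[/negbTE b3 /negbTE b4].
    by apply/funext => j; rewrite b3 b4 /= F1.
move: I1 I2 I3 C; rewrite /= sm.
case: (iteri _ _ _) => s' n /= I1 I2 I3 C; split => //; last by lia.
- by move=> j jm; rewrite I1 jm.
- by move=> j jm; rewrite I2 jm.
Qed.

End machine.

Section rounds.
Variables (R : realType) (r m T : nat) (delta : R).
Implicit Types (w : tape R) (v : nat -> 'rV[R]_m) (s : state R).

(** The mathematical counterpart of arrays 3 and 4. The two samples of a column are drawn one after
    the other, hence the even and odd tape positions. *)
Fixpoint rows w v (t : nat) : 'rV[R]_m * 'rV[R]_m :=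
  if t is t'.+1 then
    let xy := rows w v t' in
    (advance1 (v t') xy.1 xy.2, advance2 (v t') xy.1 xy.2)
  else (\row_j tape_N w j.*2, \row_j tape_N w j.*2.+1).

Definition steer_at w v t : R * R :=
  steer (v t) (rows w v t).1 (rows w v t).2.

Lemma rows_sum w v t (j : 'I_m) :
  (rows w v t).1 ord0 j =
    (rows w v 0).1 ord0 j + \sum_(s < t) (steer_at w v s).1 * v s ord0 j /\
  (rows w v t).2 ord0 j =
    (rows w v 0).2 ord0 j + \sum_(s < t) (steer_at w v s).2 * v s ord0 j.
Proof.
elim: t => [|t [IH1 IH2]]; first by rewrite !big_ord0 !addr0.
rewrite !big_ord_recr/= !addrA -IH1 -IH2 /advance1 /advance2.
by split; rewrite !mxE.
Qed.

Definition holds_rows w v t s :=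
  forall j : 'I_m, rmem s 3 j = (rows w v t).1 ord0 j /\
                   rmem s 4 j = (rows w v t).2 ord0 j.

(** The invariant between rounds. Before round 0 the rows are not drawn yet, so only the flag and
    the tape position are recorded. The clause on array 1 keeps the output coordinates beyond the
    first two at 0. *)
Definition ready w v t s :=
  [/\ ireg s 1 = m, (forall j, (2 <= j)%N -> rmem s 1 j = 0) &
      if t is 0%N then ireg s 3 = 0%N /\ draws s = 0%N
      else ireg s 3 = 1%N /\ holds_rows w v t s].

Lemma run_init_rows w v t s : ready w v t s ->
  let s' := (run w prog_init s).1 in let n := (run w prog_init s).2 in
  [/\ holds_rows w v t s', ireg s' 1 = m /\ ireg s' 3 = 1%N,
      rmem s' 0 = rmem s 0, rmem s' 1 = rmem s 1 & (n <= 10 + 5 * m)%N].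
Proof.
case: t => [|t] [sm s1 [s3]].
  move=> d0; have [h3 h4 [F1 F2] h5 h6] := run_init w sm s3 d0.
  split; [|by rewrite F2|by rewrite F1|by rewrite F1|exact: h6].
  by move=> j; rewrite h3// h4//= !mxE.
by move=> h; rewrite /prog_init run_If /= s3 /=; split.
Qed.

Lemma run_walk w v t s0 : ready w v t s0 ->
  let s := load (v t) s0 in
  let s' := (run w walk s).1 in let n := (run w walk s).2 in
  [/\ ready w v t.+1 s',
      rmem s' 1 0 = (steer_at w v t).1, rmem s' 1 1 = (steer_at w v t).2 &
      (n <= 240 + 75 * m)%N].
Proof.
move=> rd s s' n.
have rds : ready w v t s by case: rd => r1 r2 r3; split => //; case: t r3.
have v0 (j : 'I_m) : rmem s 0 j = v t ord0 j by rewrite /s/= valK.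
have [] := run_init_rows rds.
set s1 := (run w prog_init s).1; set n1 := (run w prog_init s).2.
move=> hr [sm1 s13] s10 s11 c1.
have [] := run_dots w sm1.
set s2 := (run w prog_dots s1).1; set n2 := (run w prog_dots s1).2.
move=> e0 e1 e2 [F1 F2] c2.
have [] := @run_steer _ w s2 m (v t) (rows w v t).1 (rows w v t).2.
- by rewrite e0; apply: eq_bigr => j _; rewrite s10 v0.
- by rewrite e1; apply: eq_bigr => j _; rewrite s10 v0; have [-> _] := hr j.
- by rewrite e2; apply: eq_bigr => j _; rewrite s10 v0; have [_ ->] := hr j.
set s3 := (run w prog_steer s2).1; set n3 := (run w prog_steer s2).2.
move=> u0 u1 u2 [F3 F4] c3.
have sm3 : ireg s3 1 = m by rewrite F4// F2.
have [] := run_move w sm3.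
set s4 := (run w prog_move s3).1; set n4 := (run w prog_move s3).2.
move=> h3 h4 [F5 F6] c4.
have s30 : rmem s3 0 = rmem s 0 by rewrite F3// F1// s10.
have e : run w walk s = (s4, n1 + (n2 + (n3 + n4)))%N 
  by rewrite /walk run_Seq -/s1 -/n1 run_Seq -/s2 -/n2 run_Seq -/s3 -/n3 -/s4 -/n4.
rewrite /s' /n e; clearbody s1 s2 s3 s4 n1 n2 n3 n4; split => /=.
- split; first by rewrite F6.
    by move=> j j2; rewrite F5// u2// F1// s11; case: rd => _ + _; apply.
  split; first by rewrite F6// F4// F2.
  move=> j; rewrite h3// h4// u0 u1 s30 v0 !F3// !F1//.
  by have [-> ->] := hr j; rewrite /advance1 /advance2 !mxE.
- by rewrite F5.
- by rewrite F5.
- by move: c1 c2 c3 c4; lia.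
Qed.

Lemma ready_before w v t : ready w v t (state_before r T delta walk w v t).
Proof.
elim: t => [|t IH]; first by split.
by have [] := run_walk IH.
Qed.

Lemma output_walk w v t (j : 'I_r) : output r T delta walk w v t ord0 j =
  if j == 0%N :> nat then (steer_at w v t).1 else
  if j == 1%N :> nat then (steer_at w v t).2 else 0.
Proof.
have [[_ h2 _] h0 h1 _] := run_walk (ready_before w v t).
rewrite mxE /round; case: eqP => [->//|j0]; case: eqP => [->//|j1].
by apply: h2; lia.
Qed.

Lemma round_time_walk w v t : (0 < m)%N -> (2 <= r)%N ->
  (round_time r T delta walk w v t <= 400 * (m * r))%N.
Proof.
move=> m0 r2; have [_ _ _ h] := run_walk (ready_before w v t).
apply: leq_trans h _; nia.
Qed.

Lemma dotp_output w v (s t : nat) : (2 <= r)%N ->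
  dotp (output r T delta walk w v s) (output r T delta walk w v t) =
  (steer_at w v s).1 * (steer_at w v t).1 +
  (steer_at w v s).2 * (steer_at w v t).2.
Proof.
move=> r2; rewrite /dotp.
under eq_bigr do rewrite !output_walk.
case: r r2 => [|[|r']]// _.
rewrite !big_ord_recl/= big1 ?addr0// => j _; by rewrite mul0r.
Qed.

Lemma norm2_output w v t : (2 <= r)%N -> norm2 (v t) <= 1 ->
  norm2 (output r T delta walk w v t) = 1.
Proof.
move=> r2 v1; rewrite /norm2 dotp_output// -!expr2 steer_unit ?sqrtr1//.
by rewrite -sqrtr1 ler_sqrt in v1.
Qed.

End rounds.

(** * Maxima of linear forms in a planar Gaussian *)

Section auerbach.
Variable R : realType.

(** Choose the pair with the largest determinant: by Cramer's rule the coefficients are ratios of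
    determinants to the largest one. *)
Lemma auerbach_plane (m : nat) (c d : 'I_m -> R) (j0 : 'I_m) :
  exists (p q : 'I_m) (a b : 'I_m -> R), forall j,
    [/\ c j = a j * c p + b j * c q, d j = a j * d p + b j * d q,
        `|a j| <= 1 & `|b j| <= 1].
Proof.
pose D (p q : 'I_m) := c p * d q - d p * c q.
have [[p q] _ /= Dmax] := @Order.TotalTheory.arg_maxP _ R _ (j0, j0) xpredT
  (fun pq => `|D pq.1 pq.2|) isT.
have {}Dmax i k : `|D i k| <= `|D p q| by exact: (Dmax (i, k)).
have [D0|D0] := eqVneq (D p q) 0; last first.
  exists p, q, (fun j => D j q / D p q), (fun j => D p j / D p q) => j.
  have Dpos : 0 < `|D p q| by rewrite normr_gt0.
  split; rewrite ?normrM ?normfV ?ler_pdivrMr ?mul1r//.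
    by move: D0; rewrite /D => D0; field.
  by move: D0; rewrite /D => D0; field.
(* All determinants vanish, so the points lie on a line through the origin; the longest of them
   serves as basis, with the projection as coefficient. *)
have Dz i k : D i k = 0.
  by apply/eqP; rewrite -normr_le0 (le_trans (Dmax i k))// D0 normr0.
have [l _ lmax] := @Order.TotalTheory.arg_maxP _ R _ j0 xpredT
  (fun j => c j ^+ 2 + d j ^+ 2) isT.
set n := c l ^+ 2 + d l ^+ 2 in lmax.
have [n0|n0] := eqVneq n 0.
  exists l, l, (fun=> 0), (fun=> 0) => j; rewrite !mul0r !addr0 normr0 ler01.
  have := lmax j isT; rewrite /= n0 => cd0.
  have : c j ^+ 2 + d j ^+ 2 == 0.
    by rewrite eq_le cd0 addr_ge0// sqr_ge0.
  by rewrite paddr_eq0 ?sqr_ge0// !sqrf_eq0 => /andP[/eqP -> /eqP ->].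
have n_gt0 : 0 < n by rewrite lt_neqAle eq_sym n0 addr_ge0 ?sqr_ge0.
exists l, l, (fun j => (c j * c l + d j * d l) / n), (fun=> 0) => j.
have e : c j * d l - d j * c l = 0 by exact: Dz.
rewrite !mul0r !addr0 normr0 ler01; split => //.
- apply: (mulIf n0); rewrite mulrAC divfK// -[RHS]addr0 -(mul0r (d l)) -e /n; ring.
- apply: (mulIf n0); rewrite mulrAC divfK// -[RHS]subr0 -(mul0r (c l)) -e /n; ring.
- rewrite normrM normfV (gtr0_norm n_gt0) ler_pdivrMr// mul1r.
  rewrite -(@ler_pXn2r _ 2)// ?nnegrE ?normr_ge0 ?(ltW n_gt0)// real_normK ?num_real//.
  (* Lagrange's identity; its determinant term is 0 here. *)
  have -> : (c j * c l + d j * d l) ^+ 2 =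
      (c j ^+ 2 + d j ^+ 2) * n - (c j * d l - d j * c l) ^+ 2.
    by rewrite /n; ring.
  rewrite e expr0n subr0 expr2 ler_wpM2r// ?(ltW n_gt0)//.
  exact: lmax.
Qed.

End auerbach.

Section first_moment.
Variable R : realType.
Notation mR := (measurableTypeR R).
Notation lam := (@lebesgue_measure R).
Local Open Scope ereal_scope.

(** A pointwise comparison with a wider normal density of total mass 1: from |u| <= 1 + u^2 / 4 <=
    exp(u^2 / 4) at u = x / s, |x| times the density of deviation s is at most w times that of
    deviation w = sqrt 2 s. *)
Lemma normal_abs_moment (s : R) : (0 < s)%R ->
  \int[normal_prob 0 s]_x `|x|%:E <= (Num.sqrt 2 * s)%:E.
Proof.
move=> s0; have sn0 : s != 0%R by rewrite gt_eqF.
have w0 : (0 < Num.sqrt 2 :> R)%R by rewrite sqrtr_gt0.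
have wn0 : (Num.sqrt 2 != 0 :> R)%R by rewrite gt_eqF.
have mn : measurable_fun setT (fun x : mR => `|x|%:E : \bar R).
  by apply/measurable_EFinP; exact: normr_measurable.
have n0 (x : mR) : 0 <= `|x|%:E :> \bar R by rewrite lee_fin.
rewrite (@ge0_integral_density _ mR R lam (normal_prob 0 s) (normal_pdf 0 s)
  (measurable_normal_pdf 0 s) (normal_pdf_ge0 0 s) (fun _ _ => erefl) _ mn n0).
have mp t : measurable_fun setT (fun x : mR => (normal_pdf 0 t x)%:E : \bar R).
  by apply/measurable_EFinP; exact: measurable_normal_pdf.
set w := (Num.sqrt 2 * s)%R.
have wp : (0 < w)%R by rewrite mulr_gt0.
have key : \int[lam]_x (w%:E * (normal_pdf 0 w x)%:E) = w%:E.
  rewrite ge0_integralZl//.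
  - by rewrite integral_normal_pdf mule1.
  - by move=> x _; rewrite lee_fin normal_pdf_ge0.
  - by rewrite lee_fin ltW.
rewrite -key; apply: ge0_le_integral => //.
- by move=> x _; rewrite mule_ge0// lee_fin normal_pdf_ge0.
- exact: emeasurable_funM.
- by apply: emeasurable_funM => //; exact: mp.
move=> x _; rewrite -!EFinM lee_fin !normal_pdfE// ?gt_eqF//.
rewrite /normal_fun subr0 /normal_peak.
have -> : (w ^+ 2 * pi *+ 2 = 2 * (s ^+ 2 * pi *+ 2))%R.
  by rewrite /w exprMn sqr_sqrtr// -[LHS]mulr_natr -[in RHS]mulr_natr; ring.
rewrite sqrtrM// invfM.
set k := (Num.sqrt (s ^+ 2 * pi *+ 2))^-1%R.
have k0 : (0 <= k)%R by rewrite invr_ge0 sqrtr_ge0.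
have -> : (w * ((Num.sqrt 2)^-1 * k * expR (- x ^+ 2 / (w ^+ 2 *+ 2))) =
    k * (s * expR (- x ^+ 2 / (w ^+ 2 *+ 2))))%R by rewrite /w; field.
rewrite mulrCA ler_wpM2l//.
have -> : (- x ^+ 2 / (w ^+ 2 *+ 2) =
    - x ^+ 2 / (s ^+ 2 *+ 2) + (x / s) ^+ 2 / 4)%R.
  rewrite /w exprMn sqr_sqrtr// -[(_ *+ 2)%R]mulr_natr -[(s ^+ 2 *+ 2)%R]mulr_natr.
  by field.
rewrite expRD mulrCA [leLHS]mulrC ler_wpM2l ?expR_ge0//.
have h : (`|x / s| <= expR ((x / s) ^+ 2 / 4))%R.
  apply: le_trans (expR_ge1Dx _).
  rewrite -[((x / s) ^+ 2)%R]real_normK ?num_real//.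
  by have := sqr_ge0 (`|x / s| - 2)%R; lra.
rewrite -(@ler_pM2l _ s^-1%R) ?invr_gt0// mulKf//.
by move: h; rewrite normrM normfV (gtr0_norm s0) mulrC.
Qed.

End first_moment.

Section gaussian_plane.
Context (R : realType) d (Q : measurableType d) (P : probability Q R) (n : nat)
  (g : 'I_n -> {RV P >-> R}) (S : 'M[R]_n) (U1 U2 : 'rV[R]_n).
Hypothesis gS : gaussian_vector g S.
Hypothesis SE : forall a : 'rV[R]_n,
  (a *m S *m a^T) ord0 ord0 = dotp a U1 ^+ 2 + dotp a U2 ^+ 2.
Implicit Types a : 'rV[R]_n.

Definition lin a : Q -> R := fun x => \sum_(s < n) a ord0 s * g s x.

Lemma measurable_lin a : measurable_fun setT (lin a).
Proof. by apply: measurable_sum => s; exact: measurable_funM. Qed.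

(** The variance is 0, so [gauss_law] is a point mass. Linear relations in the plane thus become
    almost sure relations between the variables, without a joint density. *)
Lemma lin_null a : dotp a U1 = 0 -> dotp a U2 = 0 ->
  {ae P, forall x, lin a x = 0}.
Proof.
move=> a1 a2; exists (lin a @^-1` ~` [set 0]); split.
- rewrite -[X in measurable X]setTI; apply: measurable_lin => //.
  exact: measurableC.
- have m0 : measurable (~` [set (0 : R)]) by exact: measurableC.
  rewrite (gS a m0) SE a1 a2 expr0n addr0 /gauss_law eqxx.
  by rewrite diracE memNset//= => h; apply: h.
- by move=> x /=.
Qed.

Local Open Scope ereal_scope.

Lemma lin_abs_moment a (B : R) : (0 <= B)%R ->
  (dotp a U1 ^+ 2 + dotp a U2 ^+ 2 <= B ^+ 2)%R ->
  \int[P]_x `|lin a x|%:E <= (Num.sqrt 2 * B)%:E.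
Proof.
move=> B0; set v := (_ + _)%R => vB.
have v0 : (0 <= v)%R by rewrite addr_ge0// sqr_ge0.
have mn : measurable_fun setT (fun x : R => `|x|%:E : \bar R).
  by apply/measurable_EFinP; exact: normr_measurable.
have [vz|vn] := eqVneq v 0%R.
  rewrite (@ae_eq_integral _ _ _ P setT (cst 0)) //.
  - by rewrite integral0 lee_fin mulr_ge0// sqrtr_ge0.
  - by apply: (measurableT_comp mn); exact: measurable_lin.
  - have /eqP := vz; rewrite paddr_eq0 ?sqr_ge0// !sqrf_eq0 => /andP[/eqP a1 /eqP a2].
    apply: filterS (lin_null a1 a2) => x h _.
    by rewrite h normr0.
have sv : (0 < Num.sqrt v)%R by rewrite sqrtr_gt0 lt_neqAle eq_sym vn.
have -> : \int[P]_x `|lin a x|%:E = \int[normal_prob 0 (Num.sqrt v)]_y `|y|%:E.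
  have ml : measurable_fun setT (lin a : Q -> measurableTypeR R).
    exact: measurable_lin.
  transitivity (\int[push_measure P ml]_y `|y|%:E).
    by rewrite (ge0_integral_pushforward ml _ measurableT mn).
  apply: eq_measure_integral => A mA _.
  transitivity (P (lin a @^-1` A)) => //.
  by rewrite (gS a mA) SE -/v /gauss_law (negbTE vn).
apply: le_trans (normal_abs_moment sv) _.
rewrite lee_fin ler_wpM2l ?sqrtr_ge0//.
by rewrite -[leRHS](ger0_norm B0) -sqrtr_sqr ler_wsqrtr.
Qed.

Lemma mx_norm_le (m : nat) (x : 'rV[R]_m) (c : R) : (0 <= c)%R ->
  (forall j, `|x ord0 j| <= c)%R -> (`|x| <= c)%R.
Proof.
move=> c0 h; rewrite [leLHS]/Num.Def.normr /= mx_normrE; apply/bigmax_leP; split => //.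
by move=> [i j] _ /=; rewrite (ord1 i).
Qed.

Lemma measurable_bigmax (I : Type) (r : seq I) (F : I -> Q -> R) :
  (forall i, measurable_fun setT (F i)) ->
  measurable_fun setT (fun x => \big[Num.max/0%R]_(i <- r) F i x).
Proof.
move=> mF; elim: r => [|i r IH].
  rewrite (_ : (fun _ => _) = cst 0%R); first exact: measurable_cst.
  by apply/funext => x; rewrite big_nil.
rewrite (_ : (fun _ => _) = F i \max (fun x => \big[Num.max/0%R]_(i <- r) F i x)).
  exact: measurable_maxr.
by apply/funext => x; rewrite big_cons.
Qed.

Lemma measurable_row_norm (m : nat) (X : Q -> 'rV[R]_m) :
  (forall j, measurable_fun setT (fun x => X x ord0 j)) ->
  measurable_fun setT (fun x => `|X x|%R).
Proof.
move=> mX; have -> : (fun x => `|X x|%R) =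
    (fun x => \big[Num.max/0%R]_(ij : 'I_1 * 'I_m) `|X x ij.1 ij.2|%R).
  by apply/funext => x; rewrite [LHS]/Num.Def.normr /= mx_normrE.
apply: measurable_bigmax => -[i j] /=; rewrite (ord1 i).
by apply: measurableT_comp; [exact: normr_measurable|exact: mX].
Qed.

Lemma lin_row_norm_moment (m : nat) (a : 'I_m -> 'rV[R]_n) (X : Q -> 'rV[R]_m)
    (B : R) : (0 < m)%N -> (0 <= B)%R ->
  (forall x j, X x ord0 j = lin (a j) x) ->
  (forall j, dotp (a j) U1 ^+ 2 + dotp (a j) U2 ^+ 2 <= B ^+ 2)%R ->
  \int[P]_x `|X x|%:E <= (2 * (Num.sqrt 2 * B))%:E.
Proof.
move=> m0 B0 XE aB.
have [p [q [al [be ab]]]] := auerbach_plane (fun j => dotp (a j) U1)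
  (fun j => dotp (a j) U2) (Ordinal m0).
have mn (b : 'rV[R]_n) : measurable_fun setT (fun x => `|lin b x|%:E : \bar R).
  apply/measurable_EFinP/measurableT_comp; first exact: normr_measurable.
  exact: measurable_lin.
have n0 (b : 'rV[R]_n) x : 0 <= `|lin b x|%:E :> \bar R by rewrite lee_fin.
(* The difference of the two sides is the form of a row orthogonal to [U1] and [U2], so [lin_null]
   applies; there are finitely many [j]. *)
have aeq : {ae P, forall x, forall j,
    lin (a j) x = al j * lin (a p) x + be j * lin (a q) x}%R.
  apply: filter_forall => j; have [/= e1 e2 _ _] := ab j.
  have z1 : dotp (a j - al j *: a p - be j *: a q)%R U1 = 0%R.
    by rewrite !dotpBl !dotpZl {1}e1; ring.
  have z2 : dotp (a j - al j *: a p - be j *: a q)%R U2 = 0%R.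
    by rewrite !dotpBl !dotpZl {1}e2; ring.
  apply: filterS (lin_null z1 z2) => x h; apply/eqP.
  rewrite -subr_eq0 -[X in _ == X]h; apply/eqP.
  rewrite /lin !mulr_sumr -big_split -sumrB /=.
  by apply: eq_bigr => s _; rewrite !mxE; ring.
apply: (@le_trans _ _ (\int[P]_x (`|lin (a p) x|%:E + `|lin (a q) x|%:E))).
  apply: ae_ge0_le_integral => //.
  - apply/measurable_EFinP/measurable_row_norm => j.
    by under eq_fun do rewrite XE; exact: measurable_lin.
  - by move=> x _; rewrite adde_ge0.
  - exact: emeasurable_funD.
  apply: filterS aeq => x h _; rewrite -EFinD lee_fin.
  apply: mx_norm_le => [|j]; first by rewrite addr_ge0.
  have [_ _ a1 b1] := ab j.
  rewrite XE h (le_trans (ler_normD _ _))// !normrM lerD// ler_piMl//.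
rewrite ge0_integralD// mulr2n mulrDl !mul1r EFinD.
by rewrite leeD// lin_abs_moment.
Qed.

End gaussian_plane.

(** * Gaussian tails and the union bound *)

Section tails.
Variable R : realType.
Notation mR := (measurableTypeR R).

(** Adjoin an independent second coordinate: it can only enlarge the squared norm, whose tail is
    known exactly. *)
Lemma normal_sqr_tail (l : R) : 0 <= l ->
  (normal_prob 0%R 1%R [set x : R | (l < x ^+ 2)%R] <= (expR (- l / 2))%:E)%E.
Proof.
move=> l0.
have mS : measurable ([set x : R | l < x ^+ 2] : set mR).
  rewrite (_ : [set x | _] = (fun x : R => x ^+ 2) @^-1` `]l, +oo[%classic); last first.
    by apply/seteqP; split => x /=; rewrite in_itv/= andbT.
  rewrite -[X in measurable X]setTI; exact: measurable_funX.
have mn : measurable (nsq (R := R) @^-1` `[l, +oo[%classic : set (mR * mR)).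
  by rewrite -[X in measurable X]setTI; exact: measurable_nsq.
rewrite -(nsq_gauss_tail l0).
have -> : normal_prob 0 1 [set x : R | l < x ^+ 2] =
    gauss2 R ([set x : R | l < x ^+ 2] `*` setT).
  by rewrite gauss2X// probability_setT mule1.
apply: le_measure; rewrite ?inE//; first exact: measurableX.
move=> [x y] [/= lx _]; rewrite in_itv/= andbT /nsq/=.
by rewrite (le_trans (ltW lx))// lerDl sqr_ge0.
Qed.

Lemma probability_bigsetU_le d (T : measurableType d) (P : probability T R)
    (I : Type) (s : seq I) (F : I -> set T) : (forall i, measurable (F i)) ->
  (P (\big[setU/set0]_(i <- s) F i) <= \sum_(i <- s) P (F i))%E.
Proof.
move=> mF; elim: s => [|i s IH]; first by rewrite !big_nil measure0.
rewrite !big_cons; apply: le_trans (leeD2l _ IH).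
apply: measureU2 => //; exact: bigsetU_measurable.
Qed.

Lemma row_quadratic_gram (n r : nat) (u : 'I_n -> 'rV[R]_r) (U1 U2 a : 'rV[R]_n) :
  (forall i k, dotp (u i) (u k) =
    U1 ord0 i * U1 ord0 k + U2 ord0 i * U2 ord0 k) ->
  (a *m gram u *m a^T) ord0 ord0 = dotp a U1 ^+ 2 + dotp a U2 ^+ 2.
Proof.
move=> uE; rewrite mxE !expr2 {2 4}/dotp !mulr_sumr -big_split/=.
apply: eq_bigr => k _; rewrite !mxE.
under eq_bigr do rewrite mxE uE mulrDr.
rewrite big_split/= mulrDl; congr (_ + _); rewrite /dotp !mulr_suml;
  by apply: eq_bigr => i _; ring.
Qed.

Lemma random_source_iid_rows d (Omega : measurableType d) (P : probability Omega R)
    (U N : nat -> {RV P >-> R}) (m : nat) : random_source U N ->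
  iid_rows P (fun w => \row_(j < m) N j.*2 w) (fun w => \row_(j < m) N j.*2.+1 w).
Proof.
move=> [_ hN ind].
pose idx (bj : bool * 'I_m) : nat := if bj.1 then (bj.2).*2 else (bj.2).*2.+1.
have idxI : injective idx.
  move=> [b j] [b' j']; rewrite /idx/=; case: b; case: b' => h;
    by [congr pair; apply/val_inj => /=; lia|lia].
have WE bj w : ((if bj.1 then \row_(j < m) N j.*2 w else \row_(j < m) N j.*2.+1 w)
    : 'rV[R]_m) ord0 bj.2 = N (idx bj) w.
  by rewrite /idx; case: bj => -[] j /=; rewrite mxE.
apply: (@eq_iid_normal _ _ _ _ _ (fun bj w => N (idx bj) w)) => [bj w|].
  by rewrite WE.
split=> [bj|A mA]; first exact: measurable_funPT.
(* The events [A] carried along the injection [idx]; every other draw, uniform ones included, gets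
   the full set. *)
pose B (i : nat + nat) : set R := if i is inr k then
  (if [pick bj | idx bj == k] is Some bj then A bj else setT) else setT.
have BE bj : B (inr (idx bj)) = A bj.
  rewrite /B; case: pickP => [bj' /eqP/idxI -> //|/(_ bj)]; by rewrite eqxx.
have mB i : measurable (B i) by rewrite /B; case: i => // k; case: pickP.
pose J : seq (nat + nat) := [seq inr (idx bj) | bj <- enum {: bool * 'I_m}].
have uJ : uniq J.
  by rewrite map_inj_uniq ?enum_uniq// => x y [/idxI].
have := ind J B uJ mB; rewrite big_map big_enum/= => e.
transitivity (\prod_bj P (N (idx bj) @^-1` B (inr (idx bj))))%E; last first.
  by apply: eq_bigr => bj _; rewrite BE; exact: hN.
rewrite -e; congr (P _); apply/seteqP; split => w /=.
  by move=> h i /= /mapP[bj _ ->]; have := h bj; rewrite -BE.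
move=> h bj; rewrite -BE; apply: (h (inr (idx bj))).
by apply/mapP; exists bj => //; rewrite mem_enum.
Qed.

End tails.

(** * Union bound over rounds, rows and columns, and the resulting constants *)

Theorem theorem10 (R : realType) :
  exists (C : R) (K : nat) (alg : cmd),
    0 < C /\
    forall (r m T : nat) (delta : R),
      (2 <= r)%N -> (0 < m)%N -> (0 < T)%N -> 0 < delta < 1 ->
      forall v : nat -> 'rV[R]_m,
        (forall t : nat, (t < T)%N -> norm2 (v t) <= 1) ->
        (forall (w : tape R) (t : nat), (t < T)%N ->
           norm2 (output r T delta alg w v t) = 1 /\
           (round_time r T delta alg w v t <= K * (m * r))%N) /\
        (2 <= m%:R * T%:R / delta ->
         forall (d : measure_display) (Omega : measurableType d)
           (P : probability Omega R) (U N : nat -> {RV P >-> R}),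
           random_source U N ->
           exists E : set Omega,
             [/\ measurable E, ((1 - delta)%:E <= P E)%E
               & forall omega : Omega, E omega ->
                 let u := fun t : 'I_T =>
                   output r T delta alg
                     (Tape (fun k => U k omega) (fun k => N k omega)) v t in
                 forall (d' : measure_display) (Omega' : measurableType d')
                   (Q : probability Omega' R) (g : 'I_T -> {RV Q >-> R}),
                   gaussian_vector g (gram u) ->
                   (\big[maxe/-oo]_(t < T)
                      'E_Q[fun x => `|\sum_(s < T | (s <= t)%N) g s x *: v s|%R]
                    <= (C * Num.sqrt (ln (m%:R * T%:R / delta)))%:E)%E]).
Proof.
(* 2 sqrt 2 sqrt 48 = sqrt 384 <= 20, and 240 + 75 m <= 400 m r. *)
exists 20, 400%N, walk; split; first by [].
move=> r m T delta r2 m0 T0 /andP[d0 d1] v v1; split.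
  move=> w t tT; split; first by apply: norm2_output => //; exact: v1.
  exact: round_time_walk.
set M := m%:R * T%:R / delta => M2 d Omega P U N src.
have M0 : 0 < M by lra.
set L := ln M.
have L0 : 0 <= L by apply: ln_ge0; lra.
pose tp omega := Tape (fun k => U k omega) (fun k => N k omega).
have iid t : (t <= T)%N -> iid_rows P (fun omega => (rows (tp omega) v t).1)
    (fun omega => (rows (tp omega) v t).2).
  elim: t => [_|t IH tT]; first exact: random_source_iid_rows src.
  apply: (iid_rows_advance _ (IH (ltnW tT))).
  by have := v1 _ tT; rewrite /norm2 -{1}sqrtr1 ler_sqrt.
pose W (i : 'I_T.+1 * (bool * 'I_m)) omega : R :=
  (if i.2.1 then (rows (tp omega) v i.1).1 else (rows (tp omega) v i.1).2) ord0 i.2.2.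
(* The threshold 6 L makes each event have probability at most exp(-3 L) = M^-3. Indices run over
   W_0, ..., W_T, hence ['I_T.+1]. *)
pose bad i := [set omega | 6 * L < W i omega ^+ 2].
have mS : measurable [set x : R | 6 * L < x ^+ 2].
  rewrite (_ : [set x | _] = (fun x : R => x ^+ 2) @^-1` `]6 * L, +oo[%classic); last first.
    by apply/seteqP; split => x /=; rewrite in_itv/= andbT.
  by rewrite -[X in measurable X]setTI; exact: measurable_funX.
have iT (i : 'I_T.+1) : (i <= T)%N by rewrite -ltnS.
have mW i : measurable_fun setT (W i).
  by have [mW _] := iid _ (iT i.1); exact: (mW i.2).
have mbad i : measurable (bad i).
  by rewrite -[X in measurable X]setTI; exact: (mW i measurableT _ mS).
have Pbad i : (P (bad i) <= (expR (- (6 * L) / 2))%:E)%E.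
  rewrite (_ : P _ = normal_prob 0 1 [set x : R | 6 * L < x ^+ 2]).
    by apply: normal_sqr_tail; rewrite mulr_ge0.
  exact: (iid_normal_marginal i.2 (iid _ (iT i.1)) mS).
pose F := \big[setU/set0]_(i : 'I_T.+1 * (bool * 'I_m)) bad i.
have mF : measurable F by apply: bigsetU_measurable => i _; exact: mbad.
exists (~` F); split; first exact: measurableC.
  rewrite probability_setC// EFinB leeB//.
  apply: (le_trans (probability_bigsetU_le P _ mbad)).
  apply: (@le_trans _ _ (\sum_(i : 'I_T.+1 * (bool * 'I_m)) (expR (- (6 * L) / 2))%:E)%E).
    by apply: lee_sum => i _; exact: Pbad.
  rewrite sumEFin lee_fin sumr_const !card_prod card_bool !card_ord.
  have -> : - (6 * L) / 2 = 3%:R * (- L) by field.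
  rewrite expRM_natl expRN /L lnK ?posrE// -[leLHS]mulr_natr.
  rewrite exprVn mulrC ler_pdivrMr ?exprn_gt0//.
  have Md : M * delta = m%:R * T%:R by rewrite /M divfK// gt_eqF.
  (* There are 2 m (T + 1) <= 4 m T = 4 M delta events, and 4 M <= M^3 because M >= 2. *)
  apply: (@le_trans _ _ (4 * (M * delta))).
    rewrite Md -!natrM ler_nat; nia.
  rewrite -subr_ge0 [X in 0 <= X](_ : _ = M * delta * ((M - 2) * (M + 2))).
    by rewrite mulr_ge0// mulr_ge0//; lra.
  by ring.
move=> omega nF u d' Omega' Q g gu.
have good i : W i omega ^+ 2 <= 6 * L.
  rewrite leNgt; apply/negP => b; apply: nF; rewrite /F -bigcup_seq.
  by exists i => //=; rewrite mem_index_enum.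
pose ch t := steer_at (tp omega) v t.
pose U1 : 'rV[R]_T := \row_s (ch s).1.
pose U2 : 'rV[R]_T := \row_s (ch s).2.
have SE a : (a *m gram u *m a^T) ord0 ord0 = dotp a U1 ^+ 2 + dotp a U2 ^+ 2.
  apply: row_quadratic_gram => i k; rewrite /u dotp_output// !mxE.
  by [].
apply: (big_ind (fun x => x <= (20 * Num.sqrt L)%:E)%E) => [|x y hx hy|t _].
- exact: leNye.
- by rewrite ge_max hx hy.
rewrite unlock.
(* Each of the two coordinates of a column of W_(t+1) - W_0 has square at most 2 (6 L + 6 L), and 24
   L + 24 L = 48 L. *)
pose B := Num.sqrt (48 * L).
apply: (@le_trans _ _ (2 * (Num.sqrt 2 * B))%:E); last first.
  rewrite lee_fin /B -[48]/(48%:R : R) sqrtrM// !mulrA ler_wpM2r ?sqrtr_ge0//.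
  rewrite -mulrA -sqrtrM// -(@ler_pXn2r _ 2)// ?nnegrE ?mulr_ge0 ?sqrtr_ge0//.
  by rewrite exprMn sqr_sqrtr//; lra.
pose a (j : 'I_m) : 'rV[R]_T := \row_s (if (s <= t)%N then v s ord0 j else 0).
apply: (@lin_row_norm_moment _ _ _ Q T g (gram u) U1 U2 gu SE m a) => //.
- exact: sqrtr_ge0.
- move=> x j; rewrite summxE /lin big_mkcond; apply: eq_bigr => s _.
  by rewrite !mxE; case: ifP => _; rewrite ?mul0r// mulrC.
move=> j; rewrite sqr_sqrtr ?mulr_ge0//.
(* The partial sum includes round [t] itself, so it is the displacement up to W_(t+1), not W_t. *)
have aU (c : nat -> R) : dotp (a j) (\row_s c s) = \sum_(s < t.+1) c s * v s ord0 j.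
  rewrite /dotp (big_ord_widen _ (fun s => c s * v s ord0 j) (ltn_ord t)) [RHS]big_mkcond.
  by apply: eq_bigr => s _; rewrite !mxE ltnS; case: ifP => _; rewrite ?mul0r// mulrC.
rewrite (aU (fun s => (ch s).1)) (aU (fun s => (ch s).2)).
have [s1 s2] := rows_sum (tp omega) v t.+1 j.
have h1 := good (lift ord0 t, (true, j)); have h2 := good (lift ord0 t, (false, j)).
have h3 := good (ord0, (true, j)); have h4 := good (ord0, (false, j)).
move: h1 h2 h3 h4; rewrite /W lift0 [nat_of_ord ord0]/=.
have -> : \sum_(s < t.+1) (ch s).1 * v s ord0 j =
    (rows (tp omega) v t.+1).1 ord0 j - (rows (tp omega) v 0).1 ord0 j.
  by rewrite s1 [RHS]addrC addKr.
have -> : \sum_(s < t.+1) (ch s).2 * v s ord0 j =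
    (rows (tp omega) v t.+1).2 ord0 j - (rows (tp omega) v 0).2 ord0 j.
  by rewrite s2 [RHS]addrC addKr.
clear s1 s2; set x1 := (rows _ _ t.+1).1 ord0 j; set y1 := (rows _ _ t.+1).2 ord0 j.
set x0 := (rows _ _ 0).1 ord0 j; set y0 := (rows _ _ 0).2 ord0 j.
have := sqr_ge0 (x1 + x0); have := sqr_ge0 (y1 + y0).
by rewrite /=; lra.
Qed.
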